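(* Let $\psi$ be the characteristic exponent of a Stieltjes–Lévy process. Then: (a) for any $q>0$, the equation $q+\psi(\xi)=0$ has no solution in $\mathbb{C}\setminus i\mathbb{R}$; (b) if the SL-measures $\mathcal{G}_\pm$ defining $\psi$ are supported on $[-\mu_-,+\infty)$ and $[\mu_+,+\infty)$, respectively, where $\mu_-\le0\le\mu_+$ and $\mu_-<\mu_+$, then for any $q>0$, on each of the intervals $i(\mu_-,0)$, $i(0,\mu_+)$, the equation $q+\psi(\xi)=0$ has either $0$ or $1$ solution; (c) the solution on $i(\mu_-,0)$ exists iff $\mu_-<0$ and $\psi(i(\mu_-+0))+q<0$; (d) the solution on $i(0,\mu_+)$ exists iff $\mu_+>0$ and $\psi(i(\mu_+-0))+q<0$.
   Context: Characteristic exponent: $\mathbb{E}[e^{i\xi X_t}]=e^{-t\psi(\xi)}$; $\psi$ also denotes its analytic continuation to $\mathbb{C}\setminus i((-\infty,\mu_-]\cup[\mu_+,+\infty))$, which exists for the processes below. $\psi(i(\mu_-+0))=\lim_{t\downarrow\mu_-}\psi(it)$ and $\psi(i(\mu_+-0))=\lim_{t\uparrow\mu_+}\psi(it)$, with values in $[-\infty,+\infty)$. $\mathrm{SM}_0$: non-negative measures $\mathcal{G}$ on $(0,+\infty)$ with $\int(1+t)^{-1}\mathcal{G}(dt)<\infty$; $\mathrm{SM}_\mu$ ($\mu>0$): those supported on $[\mu,+\infty)$. SL-measures of class $\mathrm{SLM}_\mu$ ($\mu\ge0$): measures $\mathcal{G}$ for which there exist $a_2,a_1\ge0$, $a_2+a_1>0$,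 with $(a_2t^2+a_1t)^{-1}\mathcal{G}(dt)\in\mathrm{SM}_\mu$. A Lévy process (with arbitrary Brownian component and drift) is a Stieltjes–Lévy (SL) process of class $SL_{\mu_-,\mu_+}$, $\mu_-\le0\le\mu_+$, if its Lévy density is $f(x)=\mathbf{1}_{(-\infty,0)}(x)\int_{(0,+\infty)}e^{tx}\mathcal{G}_-(dt)+\mathbf{1}_{(0,+\infty)}(x)\int_{(0,+\infty)}e^{-tx}\mathcal{G}_+(dt)$ with $\mathcal{G}_-\in\mathrm{SLM}_{\mu_+}$ and $\mathcal{G}_+\in\mathrm{SLM}_{-\mu_-}$. *)

(* Defs.v *)
From HB Require Import structures.
From mathcomp Require Export all_boot all_order all_algebra.
From mathcomp Require Export all_classical all_reals all_analysis.
From mathcomp Require Export complex.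
Export Order.TTheory GRing.Theory Num.Theory.
Export numFieldNormedType.Exports.

Set Implicit Arguments.
Unset Strict Implicit.
Unset Printing Implicit Defensive.

Local Open Scope classical_set_scope.
Local Open Scope ring_scope.
Local Open Scope complex_scope.

Definition cexp (R : realType) (z : R[i]) : R[i] :=
  (expR (complex.Re z))%:C * (cos (complex.Im z) +i* sin (complex.Im z)).

Definition cintegral d (T : measurableType d) (R : realType)
    (mu : {measure set T -> \bar R}) (f : T -> R[i]) : R[i] :=
  (\int[mu]_x complex.Re (f x)) +i* (\int[mu]_x complex.Im (f x)).

(** * Lévy processes *)

(* Only the values [X t] with [0 <= t] are relevant. Mutual independence of the
   increments is the product rule over all of them at once: subfamilies are
   covered by taking some of the [B i] to be [setT]. *)
Definition independent_increments d (T : measurableType d) (R : realType)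
    (P : probability T R) (X : R -> {RV P >-> R}) : Prop :=
  forall (n : nat) (t : nat -> R) (B : nat -> set R),
    0 <= t 0%N -> (forall i, (i < n)%N -> t i <= t i.+1) ->
    (forall i, measurable (B i)) ->
    P [set w | forall i, (i < n)%N -> B i (X (t i.+1) w - X (t i) w)] =
    (\prod_(i < n) P [set w | B i (X (t i.+1) w - X (t i) w)%R])%E.

Definition stationary_increments d (T : measurableType d) (R : realType)
    (P : probability T R) (X : R -> {RV P >-> R}) : Prop :=
  forall (s t : R) (B : set R), 0 <= s -> 0 <= t -> measurable B ->
    P [set w | B (X (s + t) w - X s w)] = P [set w | B (X t w)].

Definition stochastically_continuous d (T : measurableType d) (R : realType)
    (P : probability T R) (X : R -> {RV P >-> R}) : Prop :=
  forall t e : R, 0 <= t -> 0 < e ->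
    P [set w | e < `|X s w - X t w|]
      @[s --> within [set s | 0 <= s] (nbhs t)] --> 0%E.

Definition cadlag_paths d (T : measurableType d) (R : realType)
    (P : probability T R) (X : R -> {RV P >-> R}) : Prop :=
  {ae P, forall w, forall t : R, 0 <= t ->
    X s w @[s --> t^'+] --> X t w /\ (0 < t -> cvg (X s w @[s --> t^'-]))}.

Definition is_levy_process d (T : measurableType d) (R : realType)
    (P : probability T R) (X : R -> {RV P >-> R}) : Prop :=
  [/\ {ae P, forall w, X 0 w = 0},
      independent_increments X,
      stationary_increments X,
      stochastically_continuous X &
      cadlag_paths X].

(* For each real [xi] the family over [t] determines [phi xi] uniquely, although
   [cexp] is not injective. *)
Definition characteristic_exponent d (T : measurableType d) (R : realType)
    (P : probability T R) (X : R -> {RV P >-> R}) (phi : R -> R[i]) : Prop :=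
  forall t xi : R, 0 <= t ->
    cintegral P (fun w => cexp ((xi * X t w) *i)) = cexp (- t%:C * phi xi).

Definition is_levy_measure (R : realType) (F : {measure set R -> \bar R}) :
    Prop :=
  F [set 0] = 0%E /\ (\int[F]_x (Num.min 1 (x ^+ 2))%:E < +oo)%E.

(* Lévy-Khintchine formula with Brownian variance [sigma2], drift [b] and
   truncation function [\1_`[-1, 1]]. *)
Definition levy_khintchine (R : realType) (sigma2 b : R)
    (F : {measure set R -> \bar R}) (xi : R) : R[i] :=
  (sigma2 / 2 * xi ^+ 2)%:C - (b * xi) *i
  + cintegral F (fun x => 1 - cexp ((xi * x) *i)
                          + (xi * x * \1_(`[-1, 1]%classic : set R) x) *i).

Definition levy_triplet d (T : measurableType d) (R : realType)
    (P : probability T R) (X : R -> {RV P >-> R}) (sigma2 b : R)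
    (F : {measure set R -> \bar R}) : Prop :=
  [/\ 0 <= sigma2, is_levy_measure F &
      characteristic_exponent X (levy_khintchine sigma2 b F)].

(** * Stieltjes-Lévy processes *)

(* A measure on (0, +oo) is a measure on [R] that is null on (-oo, 0]. *)
Definition on_positive_reals (R : realType) (G : {measure set R -> \bar R}) :
    Prop :=
  G `]-oo, 0]%classic = 0%E.

Definition SM (R : realType) (m : R) (G : {measure set R -> \bar R}) : Prop :=
  [/\ on_positive_reals G,
      (\int[G]_(t in `]0%R, +oo[) ((1 + t)^-1)%:E < +oo)%E &
      G `]-oo, m[%classic = 0%E].

Definition SLM (R : realType) (m : R) (G : {measure set R -> \bar R}) : Prop :=
  on_positive_reals G /\
  exists (a2 a1 : R) (H : {measure set R -> \bar R}),
    [/\ 0 <= a2, 0 <= a1, 0 < a2 + a1,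
        (forall A : set R, measurable A ->
           H A = (\int[G]_(t in A `&` `]0%R, +oo[)
                    ((a2 * t ^+ 2 + a1 * t)^-1)%:E)%E) &
        SM m H].

(* The inner integrals may be [+oo] at [x = 0], where both indicators vanish and
   [0 * +oo = 0]. *)
Definition SL_density (R : realType) (Gm Gp : {measure set R -> \bar R})
    (x : R) : \bar R :=
  ((\1_(`]-oo, 0%R[%classic : set R) x)%:E
     * \int[Gm]_(t in `]0%R, +oo[) (expR (t * x))%:E
   + (\1_(`]0%R, +oo[%classic : set R) x)%:E
     * \int[Gp]_(t in `]0%R, +oo[) (expR (- (t * x)))%:E)%E.

Definition is_SL_process d (T : measurableType d) (R : realType)
    (P : probability T R) (X : R -> {RV P >-> R}) (mum mup : R) : Prop :=
  is_levy_process X /\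
  exists (sigma2 b : R) (F Gm Gp : {measure set R -> \bar R}),
    [/\ levy_triplet X sigma2 b F,
        SLM mup Gm, SLM (- mum) Gp &
        forall A : set R, measurable A ->
          F A = (\int[lebesgue_measure]_(x in A) SL_density Gm Gp x)%E].

(** * Analytic continuation of the characteristic exponent *)

Definition analytic_on (R : realType) (D : set R[i]) (f : R[i] -> R[i]) :
    Prop :=
  forall z, D z -> exists (c : nat -> R[i]) (r : R), 0 < r /\
    forall w, `|w - z| < r%:C ->
      (fun n => (\sum_(0 <= k < n) c k * (w - z) ^+ k : (R[i])^o)) @ \oo
        --> (f w : (R[i])^o).

(* The plane without i((-oo, mum] `|` [mup, +oo)). *)
Definition SL_domain (R : realType) (mum mup : R) : set R[i] :=
  ~` [set y *i | y in `]-oo, mum]%classic `|` `[mup, +oo[%classic].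

(* When [mum] or [mup] is [0], the origin is outside [SL_domain mum mup]; there
   [psi] is fixed by the first clause. *)
Definition continued_characteristic_exponent d (T : measurableType d)
    (R : realType) (P : probability T R) (X : R -> {RV P >-> R}) (mum mup : R)
    (psi : R[i] -> R[i]) : Prop :=
  characteristic_exponent X (fun xi => psi xi%:C) /\
  analytic_on (SL_domain mum mup) psi.

Definition imaginary_interval (R : realType) (a b : R) : set R[i] :=
  [set y *i | y in `]a, b[%classic].

Definition solutions (R : realType) (psi : R[i] -> R[i]) (q : R)
    (D : set R[i]) : set R[i] :=
  [set xi | D xi /\ q%:C + psi xi = 0].

(* [psi] is real-valued on i(mum, mup), so that its boundary values there are
   limits of the real part, taken in [\bar R] as they may be [-oo]. *)
Definition psi_lower (R : realType) (psi : R[i] -> R[i]) (mum : R) : \bar R :=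
  lim ((complex.Re (psi (t *i)))%:E @[t --> mum^'+]).

Definition psi_upper (R : realType) (psi : R[i] -> R[i]) (mup : R) : \bar R :=
  lim ((complex.Re (psi (t *i)))%:E @[t --> mup^'-]).

(* Main.v *)
(* Put z = i xi. By Tonelli, exchanging the Levy measure with the SL-measures, psi(xi) = - kappa(z)
   for real xi <> 0, where kappa(z) is a quadratic polynomial plus
     int (1/(t - z) - 1/t - z/(1 + t^2)) G_+(dt) + int (1/(t + z) - 1/t + z/(1 + t^2)) G_-(dt).
   This function has local power series off the cuts, so by the identity theorem
   psi(xi) = - kappa(z) holds on the whole domain of psi. Now kappa(z)/z is, up to a real constant, a positive
   superposition of z, 1/(t (t - z)) and - 1/(t (t + z)), each of which maps the upper half-plane to itself
   and is nondecreasing on the real axis between the cuts. Since q/z maps the upper half-plane to the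
   lower one, kappa(z) = q has no solution with Im z <> 0; since kappa(x)/x - q/x is strictly increasing
   on either side of 0, real solutions are unique there, and they exist exactly when the
   boundary value of kappa exceeds q, because kappa(x) is small near 0. *)

From HB Require Import structures.
Require Import Defs.
From mathcomp Require Import ring lra measurable_realfun.
Import Normc.

Set Implicit Arguments.
Unset Strict Implicit.
Unset Printing Implicit Defensive.

Local Open Scope classical_set_scope.
Local Open Scope ring_scope.
Local Open Scope complex_scope.

(** * Power series and the identity theorem *)

(** Tonelli's theorem wants non-negative integrands, whereas the Lévy-Khintchine integrand is
    signed. Its real and imaginary parts are dominated by a multiple of min(1, x^2); adding that
    multiple and subtracting it again reduces to the non-negative case. The Laplace transform of 1 -
    cos x is exactly 1/(t (1 + t^2)), so the integrability of the weight that controls the kernels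
    of kappa is read off the Lévy measure. The truncation and the compensator z/(1 + t^2) differ by
    a real multiple of z, a drift, which affects neither the half-plane sign nor the monotonicity of
    kappa(z)/z. The identity theorem cannot start at the origin, which lies on a cut when [mum] or
    [mup] is 0; if both are, the domain is even disconnected. It is applied in each closed
    half-plane separately, from the base points i and -i of the z-plane, because psi = - kappa is
    known on the whole imaginary z-axis except 0. *)

Section normc_theory.
Variable R : realType.
Implicit Types (x y z : R[i]) (a b : R).

Lemma normr_normc x : `|x| = (normc x)%:C.
Proof. by case: x. Qed.

Lemma normc_ge0 x : 0 <= normc x.
Proof. by case: x => a b; exact: sqrtr_ge0. Qed.

Lemma normc_eq0 x : (normc x == 0) = (x == 0).
Proof.
apply/eqP/eqP => [/eq0_normc//|->].
by rewrite -[LHS]/(normc (0 +i* 0)) normc0.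
Qed.

Lemma normc_gt0 x : (0 < normc x) = (x != 0).
Proof. by rewrite lt0r normc_ge0 andbT normc_eq0. Qed.

Lemma ler_normcD x y : normc (x + y) <= normc x + normc y.
Proof. exact: le_normcD. Qed.

Lemma ler_normcB x y : normc (x - y) <= normc x + normc y.
Proof. by apply: le_trans (ler_normcD _ _) _; rewrite normcN. Qed.

Lemma normcX x n : normc (x ^+ n) = normc x ^+ n.
Proof.
by elim: n => [|n ih]; rewrite ?expr0 ?exprS ?normcM ?ih// -[LHS]/(normc 1%:C) normc1.
Qed.

Lemma normc_real a : normc a%:C = `|a|.
Proof. by rewrite /= expr0n addr0 sqrtr_sqr. Qed.

Lemma normc_imag a : normc a*i = `|a|.
Proof. by rewrite /= expr0n add0r sqrtr_sqr. Qed.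

Lemma normc_ge_absRe x : `|complex.Re x| <= normc x.
Proof.
by case: x => a b /=; rewrite -sqrtr_sqr ler_wsqrtr// lerDl sqr_ge0.
Qed.

Lemma normc_ge_absIm x : `|complex.Im x| <= normc x.
Proof.
by case: x => a b /=; rewrite -sqrtr_sqr ler_wsqrtr// lerDr sqr_ge0.
Qed.

Lemma normc_le_ReIm x : normc x <= `|complex.Re x| + `|complex.Im x|.
Proof.
case: x => a b; have -> : a +i* b = a%:C + b*i by simpc.
by apply: le_trans (ler_normcD _ _) _; rewrite normc_real normc_imag; simpc.
Qed.

Lemma ler_normc_sum (I : Type) (r : seq I) (F : I -> R[i]) :
  normc (\sum_(k <- r) F k) <= \sum_(k <- r) normc (F k).
Proof.
elim: r => [|i r ih]; first by rewrite !big_nil -[leLHS]/(normc (0 +i* 0)) normc0.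
rewrite !big_cons; apply: le_trans (ler_normcD _ _) _.
by rewrite lerD2l.
Qed.

End normc_theory.

(* The geometric bound on all remainders replaces convergence: coefficients,
   zeros and continuity can be read off from single inequalities. *)
Definition power_series_at (R : realType) (f : R[i] -> R[i]) (z : R[i])
    (c : nat -> R[i]) (r B : R) : Prop :=
  0 < r /\ forall h, normc h < r -> forall n,
    normc (f (z + h) - \sum_(0 <= k < n) c k * h ^+ k) <= B * (normc h / r) ^+ n.

Definition has_power_series (R : realType) (f : R[i] -> R[i]) (z : R[i]) : Prop :=
  exists c r B, power_series_at f z c r B.

Section power_series.
Variable R : realType.
Implicit Types (f g : R[i] -> R[i]) (z h : R[i]).

Lemma geometric_le0 (B x : R) : 0 <= x < 1 -> forall a : R,
  (forall n, a <= B * x ^+ n) -> a <= 0.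
Proof.
move=> /andP[x0 x1] a aB; have cv : B * x ^+ n @[n --> \oo] --> B * 0.
  by apply: cvgMr; apply: cvg_expr; rewrite ger0_norm.
rewrite mulr0 in cv; rewrite -(cvg_lim _ cv)//.
by apply: limr_ge; [apply/cvg_ex; exists 0|exact: nearW].
Qed.

Lemma power_series_bound_ge0 f z c r B : power_series_at f z c r B -> 0 <= B.
Proof.
move=> [r0 /(_ 0)]; rewrite normc0 => /(_ r0 0%N).
by rewrite expr0 mulr1; apply: le_trans; exact: normc_ge0.
Qed.

(* The remainders of order 0 and 1 are controlled by the one of order 2. *)
Lemma power_series_of_ge2 f z c r B : 0 < r ->
  (forall h, normc h < r -> forall n, (2 <= n)%N ->
    normc (f (z + h) - \sum_(0 <= k < n) c k * h ^+ k) <= B * (normc h / r) ^+ n) ->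
  has_power_series f z.
Proof.
move=> r0 H.
have B0 : 0 <= B.
  have h2 : normc (r / 2)%:C < r by rewrite normc_real gtr0_norm; lra.
  have := H _ h2 2%N isT; rewrite normc_real gtr0_norm; last by lra.
  move/(le_trans (normc_ge0 _)); rewrite pmulr_lge0//.
  by rewrite exprn_gt0// divr_gt0//; lra.
(* The first two Taylor terms are absorbed by the constant, since x = |h| / r is at most 1. *)
exists c, r, (B + normc (c 0%N) + normc (c 1%N) * r); split => // h hr n.
set x := normc h / r.
have x0 : 0 <= x by rewrite divr_ge0 ?normc_ge0// ltW.
have x1 : x <= 1 by rewrite ler_pdivrMr// mul1r ltW.
have n0 := normc_ge0 (c 0%N); have n1 := normc_ge0 (c 1%N).
have hx : normc h = x * r by rewrite /x; field; lra.
case: n => [|[|n]].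
- have := H h hr 2%N isT; rewrite !big_nat_recr//= !big_nil add0r expr0 expr1 mulr1.
  rewrite -/x => H2; rewrite expr0 mulr1 subr0.
  have -> : f (z + h) = (f (z + h) - (c 0%N + c 1%N * h)) + (c 0%N + c 1%N * h) by ring.
  apply: le_trans (ler_normcD _ _) _.
  have := ler_normcD (c 0%N) (c 1%N * h); rewrite normcM hx.
  have : x ^+ 2 <= 1 by rewrite expr_le1.
  by nra.
- have := H h hr 2%N isT; rewrite !big_nat_recr//= !big_nil add0r expr0 !expr1 mulr1.
  rewrite -/x => H2.
  have -> : f (z + h) - c 0%N = (f (z + h) - (c 0%N + c 1%N * h)) + c 1%N * h by ring.
  apply: le_trans (ler_normcD _ _) _; rewrite normcM hx.
  have : x ^+ 2 <= x by rewrite expr2 ler_piMl.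
  move=> x2.
  have : B * x ^+ 2 <= B * x by rewrite ler_wpM2l.
  have : 0 <= normc (c 0%N) * x by rewrite mulr_ge0.
  by rewrite !mulrDl; lra.
- apply: le_trans (H h hr _ _) _ => //; rewrite ler_wpM2r//.
    by rewrite exprn_ge0.
  rewrite -addrA lerDl addr_ge0// mulr_ge0//; lra.
Qed.

(** Convergence at the single radius [rho] bounds the coefficients, as in Abel's lemma; on a smaller
    disc the tails are then dominated by a geometric series. This brings [analytic_on] into the form
    of [power_series_at]. *)
Lemma power_series_of_limit f z c r : 0 < r ->
  (forall h, normc h < r -> forall e : R, 0 < e -> exists N, forall n, (N <= n)%N ->
    normc (f (z + h) - \sum_(0 <= k < n) c k * h ^+ k) <= e) ->
  has_power_series f z.
Proof.
move=> r0 H; pose rho := r / 2.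
have rho0 : 0 < rho by rewrite /rho; lra.
have [M M0 HM] : exists2 M : R, 0 <= M & forall k, normc (c k) * rho ^+ k <= M.
  have hr : normc rho%:C < r by rewrite normc_real gtr0_norm// /rho; lra.
  have [N HN] := H _ hr 1 ltr01.
  pose M := \sum_(0 <= k < N) normc (c k) * rho ^+ k + 2.
  have S0 n : 0 <= \sum_(0 <= k < n) normc (c k) * rho ^+ k.
    by apply: sumr_ge0 => k _; rewrite mulr_ge0 ?normc_ge0// exprn_ge0// ltW.
  exists M; first by rewrite addr_ge0.
  move=> k; have [kN|Nk] := ltnP k N.
    rewrite /M -lerBlDr (_ : _ - 2 <= _)//.
    rewrite (@big_cat_nat _ _ _ k.+1 0 N)//=.
    rewrite big_nat_recr//=.
    have := S0 k.
    have : 0 <= \sum_(k.+1 <= i < N) normc (c i) * rho ^+ i.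
      by apply: sumr_ge0 => i _; rewrite mulr_ge0 ?normc_ge0// exprn_ge0// ltW.
    by lra.
  have -> : normc (c k) * rho ^+ k = normc (c k * rho%:C ^+ k).
    by rewrite normcM normcX normc_real gtr0_norm.
  (* A late term is the difference of two remainders, each of norm at most 1, which explains the
     summand 2 in [M]; an early term is at most the sum of all early terms. *)
  have -> : c k * rho%:C ^+ k =
     (f (z + rho%:C) - \sum_(0 <= j < k) c j * rho%:C ^+ j) -
     (f (z + rho%:C) - \sum_(0 <= j < k.+1) c j * rho%:C ^+ j).
    by rewrite big_nat_recr//=; ring.
  apply: le_trans (ler_normcB _ _) _.
  by have := HN k Nk; have := HN k.+1 (leqW Nk); have := S0 N; rewrite /M; lra.
(* On radius [rho / 2] the ratio |h| / rho is at most 1/2, so that the geometric tail from n on is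
   at most twice its first term. *)
exists c, (rho / 2), (2 * M); split; first by lra.
move=> h hr n.
set x := normc h / rho.
have x0 : 0 <= x by rewrite divr_ge0 ?normc_ge0// ltW.
have x12 : x <= 2^-1 by rewrite ler_pdivrMr//; lra.
have hx : normc h = x * rho by rewrite /x; field; lra.
have geo m : \sum_(n <= k < n + m) x ^+ k <= 2 * x ^+ n.
  rewrite -{1}(addn0 n) addnC big_addn addnC addnK.
  under eq_bigr do rewrite exprD.
  rewrite -mulr_suml mulrC [in leRHS]mulrC ler_wpM2l ?exprn_ge0//.
  have -> : \sum_(0 <= k < m) x ^+ k = (1 - x ^+ m) / (1 - x).
    have := subrX1 x m; rewrite big_mkord => E.
    have -> : 1 - x ^+ m = (1 - x) * \sum_(i < m) x ^+ i by rewrite -(opprB x) mulNr -E; ring.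
    by field; lra.
  rewrite ler_pdivrMr; last by lra.
  have : 0 <= x ^+ m by rewrite exprn_ge0.
  by lra.
have hr' : normc h < r.
  by apply: (lt_trans hr); rewrite /rho; lra.
apply: (@le_trans _ _ (2 * M * x ^+ n)); last first.
  rewrite ler_wpM2l//; first by lra.
  rewrite lerXn2r ?nnegrE ?divr_ge0 ?normc_ge0//; try lra.
  by rewrite ler_wpM2l ?normc_ge0// lef_pV2 ?posrE; lra.
apply/ler_addgt0Pr => e e0.
have [N HN] := H h hr' e e0.
have HNn := HN _ (leq_addl n N).
have -> : f (z + h) - \sum_(0 <= k < n) c k * h ^+ k =
  (f (z + h) - \sum_(0 <= k < n + N) c k * h ^+ k) + \sum_(n <= k < n + N) c k * h ^+ k.
  by rewrite (@big_cat_nat _ _ _ n 0 (n + N))//= ?leq_addr//; ring.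
apply: le_trans (ler_normcD _ _) _; rewrite addrC lerD//.
have : normc (\sum_(n <= k < n + N) c k * h ^+ k) <= \sum_(n <= k < n + N) M * x ^+ k.
  apply: le_trans (ler_normc_sum _ _) _; apply: ler_sum => k _.
  by rewrite normcM normcX hx exprMn mulrCA mulrC ler_wpM2r ?exprn_ge0.
move/le_trans; apply.
by rewrite -mulr_sumr [2 * M]mulrC -mulrA ler_wpM2l.
Qed.

Lemma power_series_at0 f z c r B : power_series_at f z c r B -> f z = c 0%N.
Proof.
move=> [r0 /(_ 0)]; rewrite normc0 => /(_ r0 1%N).
rewrite big_nat1 expr0 mulr1 mul0r expr1 mulr0 addr0 => H.
by apply/eqP; rewrite -subr_eq0 -normc_eq0 eq_le H normc_ge0.
Qed.

Lemma has_power_series_continuous f z : has_power_series f z ->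
  forall e : R, 0 < e -> exists2 d : R, 0 < d &
    forall h, normc h < d -> normc (f (z + h) - f z) <= e.
Proof.
move=> [c [r [B psf]]] e e0; have B0 := power_series_bound_ge0 psf.
have f0 := power_series_at0 psf; case: psf => r0 H.
(* Chosen so that the order-1 bound B |h| / r is at most e; B + 1 avoids division by 0. *)
exists (Num.min r (e * r / (B + 1))).
  by rewrite lt_min r0/= divr_gt0 ?mulr_gt0//; lra.
move=> h; rewrite lt_min => /andP[hr he].
have := H h hr 1%N; rewrite big_nat1 expr0 mulr1 -f0 expr1 => /le_trans; apply.
rewrite mulrA ler_pdivrMr//.
move: he; rewrite ltr_pdivlMr; last by lra.
have := normc_ge0 h; nra.
Qed.

Lemma has_power_seriesB f g z : has_power_series f z -> has_power_series g z ->
  has_power_series (fun w => f w - g w) z.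
Proof.
move=> [c [r [B psf]]] [c' [r' [B' psg]]].
have B0 := power_series_bound_ge0 psf; have B'0 := power_series_bound_ge0 psg.
case: psf psg => r0 H [r'0 H'].
have m0 : 0 < Num.min r r' by rewrite lt_min r0.
exists (fun k => c k - c' k), (Num.min r r'), (B + B'); split => // h hm n.
have [hr hr'] : normc h < r /\ normc h < r' by move: hm; rewrite lt_min => /andP.
have -> : f (z + h) - g (z + h) - \sum_(0 <= k < n) (c k - c' k) * h ^+ k =
  (f (z + h) - \sum_(0 <= k < n) c k * h ^+ k) -
  (g (z + h) - \sum_(0 <= k < n) c' k * h ^+ k).
  by under eq_bigr do rewrite mulrBl; rewrite sumrB; ring.
apply: le_trans (ler_normcB _ _) _; rewrite mulrDl.
have mono (s : R) : 0 < s -> Num.min r r' <= s ->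
    (normc h / s) ^+ n <= (normc h / Num.min r r') ^+ n.
  move=> s0 ms; rewrite lerXn2r ?nnegrE ?divr_ge0 ?normc_ge0//; try exact: ltW.
  by rewrite ler_wpM2l ?normc_ge0// lef_pV2 ?posrE.
apply: lerD; [apply: le_trans (H h hr n) _|apply: le_trans (H' h hr' n) _].
- by rewrite ler_wpM2l// mono// ge_min lexx.
- by rewrite ler_wpM2l// mono// ge_min lexx orbT.
Qed.

(** If the coefficients below n vanish, the remainder of order n + 1 at a zero z + h is just c_n
    h^n, whence |c_n| <= B |h| / r^(n+1) with |h| arbitrarily small. Once all coefficients vanish,
    |f| is below B x^n for every n, with x < 1. *)
Lemma isolated_zeros f z : has_power_series f z ->
  (forall e : R, 0 < e -> exists h, [/\ h != 0, normc h < e & f (z + h) = 0]) ->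
  exists2 r : R, 0 < r & forall h, normc h < r -> f (z + h) = 0.
Proof.
move=> [c [r [B psf]]] acc; have B0 := power_series_bound_ge0 psf.
case: psf => r0 H.
have c0 n : c n = 0.
  elim/ltn_ind: n => n ih; apply/eqP; rewrite -normc_eq0 eq_le normc_ge0 andbT.
  apply/ler_addgt0Pr => e e0; rewrite add0r.
  have rn : 0 < r ^+ n.+1 by rewrite exprn_gt0.
  have d0 : 0 < Num.min r (e * r ^+ n.+1 / (B + 1)).
    by rewrite lt_min r0/= divr_gt0 ?mulr_gt0//; lra.
  have [h [h0 + fh]] := acc _ d0; rewrite lt_min => /andP[hr he].
  have := H h hr n.+1; rewrite fh big_nat_recr//= big1_seq; last first.
    by move=> k; rewrite mem_index_iota => /ih ->; rewrite mul0r.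
  rewrite sub0r add0r normcN normcM normcX expr_div_n exprS.
  have hn : 0 < normc h ^+ n by rewrite exprn_gt0// normc_gt0.
  have -> : B * (normc h * normc h ^+ n / r ^+ n.+1) =
            (B * normc h / r ^+ n.+1) * normc h ^+ n by field; lra.
  rewrite ler_pM2r// => /le_trans; apply.
  rewrite ler_pdivrMr//.
  move: he; rewrite ltr_pdivlMr; last by lra.
  by have := normc_ge0 h; nra.
exists r => // h hr; apply/eqP; rewrite -normc_eq0 eq_le normc_ge0 andbT.
apply: (@geometric_le0 B (normc h / r)).
  by rewrite divr_ge0 ?normc_ge0 ?ltW//= ltr_pdivrMr// mul1r.
move=> n; have := H h hr n; rewrite big1 ?subr0// => k _.
by rewrite c0 mul0r.
Qed.

(** Connectedness of the segment, argued with a supremum: zeros accumulate at the last point up to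
    which f vanishes, so f vanishes beyond it. Segments suffice because the regions met later are
    star-shaped. *)
Lemma identity_on_segment f z z' :
  (forall s : R, 0 <= s <= 1 -> has_power_series f (z + s%:C * (z' - z))) ->
  (forall e : R, 0 < e -> exists h, [/\ h != 0, normc h < e & f (z + h) = 0]) ->
  f z' = 0.
Proof.
move=> psf acc; set d := z' - z.
have zd s : z + s%:C * (z' - z) = z + s%:C * d by [].
have [d0|d0] := eqVneq d 0.
  have [|r r0 H] := @isolated_zeros f z _ acc.
    by have := psf 0; rewrite zd d0 mulr0 addr0 lexx ler01; exact.
  have <- : z + 0 = z' by apply/esym/eqP; rewrite addrC -subr_eq; apply/eqP.
  by apply: H; rewrite normc0.
have nd : 0 < normc d by rewrite normc_gt0.
pose S := [set s : R | 0 <= s <= 1 /\ forall u, 0 <= u <= s -> f (z + u%:C * d) = 0].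
have S0 : S 0.
  split; first by rewrite lexx ler01.
  move=> u; rewrite -eq_le => /eqP <-; rewrite mul0r.
  have [|r r0 H] := @isolated_zeros f z _ acc.
    by have := psf 0; rewrite mul0r addr0 lexx ler01; exact.
  by apply: H; rewrite normc0.
have supS : has_sup S by split; [exists 0|exists 1 => s [/andP[]]].
set s := sup S.
have s0 : 0 <= s by apply: ub_le_sup => //; case: supS.
have s1 : s <= 1 by apply: ge_sup => [|t [/andP[]]//]; exists 0.
have [r r0 H] : exists2 r : R, 0 < r & forall h, normc h < r -> f (z + s%:C * d + h) = 0.
  apply: isolated_zeros; first by apply: psf; rewrite s0.
  have [s00|sneq0] := eqVneq s 0; first by rewrite s00 mul0r addr0.
  move=> e e0.
  have spos : 0 < s by rewrite lt_neqAle eq_sym sneq0.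
  pose m := Num.min s (e / normc d).
  have m0 : 0 < m by rewrite lt_min spos divr_gt0.
  have [t St tm] := @sup_adherent R S (m / 2) (ltac:(lra)) supS.
  have ts : t <= s by apply: ub_le_sup => //; case: supS.
  have ms : m <= s by rewrite ge_min lexx.
  have me : m <= e / normc d by rewrite ge_min lexx orbT.
  (* The parameter [t] may be the supremum itself; the minimum keeps [u] strictly below [s], so that
     the increment is nonzero. *)
  pose u := Num.min t (s - m / 2).
  exists ((u - s)%:C * d); split.
  - rewrite mulf_neq0// eq_complex /= eqxx andbT subr_eq0 lt_eqF//.
    by rewrite /u gt_min; apply/orP; right; lra.
  - rewrite normcM normc_real -ltr_pdivlMr//; apply: lt_le_trans me.
    have us : u <= s by rewrite /u ge_min ts.
    rewrite ler0_norm; last by lra.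
    have : s - m / 2 <= u by rewrite /u le_min lexx andbT; exact: ltW.
    by lra.
  - rewrite -addrA -mulrDl -rmorphD/= (addrC s) subrK.
    case: St => /andP[t0 t1]; apply; rewrite /u le_min t0/= ge_min lexx/= andbT.
    by lra.
have sd u : z + u%:C * d = z + s%:C * d + (u - s)%:C * d.
  by rewrite rmorphB/=; ring.
have Hu u : `|u - s| < r / normc d -> f (z + u%:C * d) = 0.
  by move=> us; rewrite sd; apply: H; rewrite normcM normc_real -ltr_pdivlMr.
have Ss u : 0 <= u < s -> f (z + u%:C * d) = 0.
  move=> /andP[u0 us].
  have [t [_ tS] ut] : exists2 t, S t & u < t.
    have [t St] := @sup_adherent R S (s - u) (ltac:(lra)) supS.
    by rewrite subKr => ut; exists t.
  by apply: tS; rewrite u0 ltW.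
have -> : z' = z + 1%:C * d by rewrite mul1r addrC subrK.
have [sE|sne] := eqVneq s 1.
  by apply: Hu; rewrite sE subrr normr0 divr_gt0.
have slt : s < 1 by rewrite lt_neqAle sne.
(* If the supremum were below 1, the disc of zeros around it would put the larger parameter [k] in
   [S]. *)
exfalso; pose k := Num.min 1 (s + r / normc d / 2).
have rd : 0 < r / normc d by rewrite divr_gt0.
have ks : s < k by rewrite lt_min slt/=; lra.
suff : S k by move/(ub_le_sup supS.2); rewrite leNgt ks.
split; first by rewrite ge_min lexx andbT; apply/ltW/(le_lt_trans s0).
move=> u /andP[u0 uk]; have [us|su] := ltP u s; first by apply: Ss; rewrite u0.
apply: Hu; rewrite ger0_norm ?subr_ge0//.
have : k <= s + r / normc d / 2 by rewrite ge_min lexx orbT.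
by lra.
Qed.

End power_series.

(** * Densities and the Tonelli theorem for Laplace transforms *)

(** [powR] with exponent -1 is the inverse on non-negative arguments only: it is applied to the
    square, and the factor [f x] restores the sign. At a zero of f both sides are 0. *)
Lemma measurable_funV d (T : measurableType d) (R : realType) (D : set T)
    (f : T -> R) : measurable_fun D f -> measurable_fun D (fun x => (f x)^-1).
Proof.
move=> mf; have -> : (fun x => (f x)^-1) = (fun x => f x * ((f x) ^+ 2) `^ (-1)).
  apply/funext => x; rewrite powR_inv1 ?sqr_ge0//.
  by have [->|fx0] := eqVneq (f x) 0; [rewrite invr0 mul0r|field].
apply: measurable_funM => //.
exact: (measurableT_comp (@measurable_powR R (-1)) (measurable_funX 2 mf)).
Qed.

Section density.
Local Open Scope ereal_scope.
Import HBNNSimple.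

(** The density may be +oo, like [SL_density], which is not known in advance to be finite. Both
    sides are limits over the same simple functions, for which the claim is the hypothesis on
    sets. *)
Lemma ge0_integral_density d (T : measurableType d) (R : realType)
    (mu nu : {measure set T -> \bar R}) (g : T -> \bar R) (f : T -> R) :
  measurable_fun setT g -> (forall x, 0 <= g x) ->
  (forall A, measurable A -> nu A = \int[mu]_(x in A) g x) ->
  measurable_fun setT f -> (forall x, (0 <= f x)%R) ->
  \int[nu]_x (f x)%:E = \int[mu]_x ((f x)%:E * g x).
Proof.
move=> mg g0 nuE mf f0.
have mf' : measurable_fun setT (EFin \o f) by exact/measurable_EFinP.
pose h := nnsfun_approx measurableT mf'.
have hf x : (EFin \o h ^~ x) n @[n --> \oo] --> (f x)%:E.
  by apply: (@cvg_nnsfun_approx _ _ _ _ measurableT _ mf') => // y _; rewrite lee_fin.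
have fgx x : (f x)%:E * g x = lim (((h n x)%:E * g x) @[n --> \oo]).
  apply/esym/cvg_lim => //.
  (* Where f vanishes and g is +oo the product is not continuous; there the approximations are
     identically 0. *)
  have [fx0|fx0] := eqVneq (f x) 0%R.
    rewrite fx0 mul0e; apply: cvg_near_cst; apply: nearW => n.
    have : (h n x)%:E <= (f x)%:E.
      by rewrite nnsfun_approxE; apply: le_approx => // y _; rewrite lee_fin.
    rewrite fx0 lee_fin => hn0.
    by rewrite (_ : h n x = 0%R) ?mul0e//; apply/eqP; rewrite eq_le hn0 fun_ge0.
  apply: cvgeM; [|exact: hf|exact: cvg_cst].
  have [gx|gx] := boolP (g x \is a fin_num); first exact: mule_def_fin.
  by apply: mule_def_neq0_infty => //; rewrite eqe.
have -> : \int[nu]_x (f x)%:E = lim (\int[nu]_x (h n x)%:E @[n --> \oo]).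
  rewrite -monotone_convergence//.
  - by apply: eq_integral => x _; apply/esym/cvg_lim => //; exact: hf.
  - by move=> n; apply/measurable_EFinP/measurable_funP.
  - by move=> n x _; rewrite lee_fin.
  - by move=> x _ a b ab; rewrite lee_fin; exact/lefP/nd_nnsfun_approx.
have -> : \int[mu]_x ((f x)%:E * g x) = lim (\int[mu]_x ((h n x)%:E * g x) @[n --> \oo]).
  under eq_integral do rewrite fgx.
  apply: monotone_convergence => //.
  - move=> n; apply: emeasurable_funM => //.
    exact/measurable_EFinP/measurable_funP.
  - by move=> n x _; rewrite mule_ge0 ?lee_fin.
  - move=> x _ a b ab; rewrite lee_wpmul2r// lee_fin.
    exact/lefP/nd_nnsfun_approx.
congr (lim (_ @ \oo)); apply/funext => n.
have indich r : measurable_fun setT (fun x => (r * \1_(h n @^-1` [set r]) x)%:E).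
  by apply/measurable_EFinP; exact: measurable_funM.
transitivity (\int[nu]_x
   (\sum_(y \in range (h n)) (y * \1_(h n @^-1` [set y]) x)%:E)).
  by apply: eq_integral => t tE; rewrite /= fimfunE -fsumEFin.
rewrite ge0_integral_fsum//; last by move=> m y Ey; exact: nnfun_muleindic_ge0.
transitivity (\int[mu]_x (\sum_(y \in range (h n))
    (y * \1_(h n @^-1` [set y]) x)%:E * g x)); last first.
  under eq_integral => x xE.
    rewrite -ge0_mule_fsuml => [|y]; last exact: nnfun_muleindic_ge0.
    rewrite fsumEFin // -(fimfunE _ x); over.
  by [].
rewrite ge0_integral_fsum//; last 2 first.
  - by move=> y; apply: emeasurable_funM.
  - by move=> m y Ey; rewrite mule_ge0// nnfun_muleindic_ge0.
apply: eq_fsbigr => r rhn.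
rewrite integralZl_indic_nnsfun//.
under [RHS]eq_integral do rewrite EFinM -muleA.
rewrite ge0_integralZl//.
- congr (_ * _); rewrite integral_indic// setIT nuE//.
  under [RHS]eq_integral do rewrite muleC.
  rewrite [RHS](eq_integral (g \_ (h n @^-1` [set r]))); last first.
    by move=> x xE; rewrite epatch_indic.
  by rewrite -integral_mkcond.
- by apply: emeasurable_funM => //; exact/measurable_EFinP.
- by move=> t Et; rewrite mule_ge0 ?lee_fin.
- by move: rhn; rewrite inE => -[t _ <-]; rewrite lee_fin.
Qed.

(** Used with [phi] the identity between two copies of the reals with different displays. *)
Lemma ge0_integral_density_comp d d' (T : measurableType d) (T' : measurableType d')
    (R : realType) (mu : {measure set T' -> \bar R}) (nu : {measure set T -> \bar R})
    (phi : T -> T') (g : T' -> \bar R) (f : T' -> R) :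
  measurable_fun setT phi -> measurable_fun setT g -> (forall x, 0 <= g x) ->
  (forall A, measurable A -> nu (phi @^-1` A) = \int[mu]_(x in A) g x) ->
  measurable_fun setT f -> (forall x, (0 <= f x)%R) ->
  \int[nu]_x (f (phi x))%:E = \int[mu]_x ((f x)%:E * g x).
Proof.
move=> mphi mg g0 nuE mf f0.
pose phi_mfun : {mfun T >-> T'} :=
  HB.pack phi (isMeasurableFun.Build _ _ _ _ _ mphi).
rewrite -(@ge0_integral_density _ _ _ mu (pushforward nu phi_mfun))//.
rewrite (ge0_integral_pushforward mphi nu)//; first exact/measurable_EFinP.
by move=> x _; rewrite lee_fin.
Qed.

End density.

Section laplace_tonelli.
Local Open Scope ereal_scope.
Variable R : realType.
Local Notation mu := (@lebesgue_measure R).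
Local Notation P := (`]0%R, +oo[%classic : set R).
Variables (G : {sigma_finite_measure set R -> \bar R}) (D : set R).
Hypothesis mD : measurable D.

(** The indicators sit inside the kernel so that both iterated integrals run over the whole line, as
    [fubini_tonelli] expects. *)
Let mker : measurable_fun setT
  (fun p : R * R => (\1_P p.1 * (\1_D p.2 * expR (- (p.2 * p.1))))%:E).
Proof.
apply/measurable_EFinP; apply: measurable_funM.
  by apply: measurableT_comp => //; exact: measurable_indic.
apply: measurable_funM; first by apply: measurableT_comp => //; exact: measurable_indic.
apply: measurableT_comp => //; apply: measurable_funN.
by apply: measurable_funM.
Qed.

Let measurable_expR_kernel (x : R) (A : set R) :
  measurable_fun A (fun t : R => expR (- (t * x))).
Proof.
apply: measurable_funTS.
apply: measurableT_comp => //; apply: measurable_funN.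
exact: measurable_funM.
Qed.

Let measurable_expR_kernel' (x : R) (A : set R) :
  measurable_fun A (fun t : R => expR (- (x * t))).
Proof.
apply: measurable_funTS.
apply: measurableT_comp => //; apply: measurable_funN.
exact: measurable_funM.
Qed.

Let inner (x : R) : \int[G]_t (\1_P x * (\1_D t * expR (- (t * x))))%:E =
  (\1_P x)%:E * \int[G]_(t in D) (expR (- (t * x)))%:E.
Proof.
rewrite [in RHS]integral_mkcond -ge0_integralZl ?lee_fin//; first last.
- by move=> t _; rewrite patchE; case: ifP => // _; rewrite lee_fin expR_ge0.
- by apply/(measurable_restrictT _ mD)/measurable_EFinP; exact: measurable_expR_kernel.
apply: eq_integral => t _; rewrite EFinM patchE (indicE _ D).
by case: (t \in D); rewrite /= ?mul1r ?mul0r ?mule0.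
Qed.

Lemma measurable_laplace :
  measurable_fun setT (fun x => (\1_P x)%:E * \int[G]_(t in D) (expR (- (t * x)))%:E).
Proof.
have := @measurable_fun_fubini_tonelli_F _ _ _ _ R G _ mker.
rewrite /fubini_F /= => H.
apply: (eq_measurable_fun _ (fun x _ => inner x)).
by apply: H => p; rewrite lee_fin !mulr_ge0 ?expR_ge0.
Qed.

Variable f : R -> R.
Hypotheses (mf : measurable_fun setT f) (f0 : forall x, (0 <= f x)%R).

Let mfker : measurable_fun setT
  (fun p : R * R => ((f p.1)%:E * (\1_P p.1 * (\1_D p.2 * expR (- (p.2 * p.1))))%:E)).
Proof.
apply: emeasurable_funM; last exact: mker.
have mf' : measurable_fun setT (EFin \o f) by exact/measurable_EFinP.
exact: (measurableT_comp mf' measurable_fst).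
Qed.

Let fker0 : forall p : R * R,
  (0 <= (f p.1)%:E * (\1_P p.1 * (\1_D p.2 * expR (- (p.2 * p.1))))%:E).
Proof. by move=> p; rewrite mule_ge0// lee_fin// !mulr_ge0 ?expR_ge0. Qed.

Let inner2 (t : R) :
  \int[mu]_x ((f x)%:E * (\1_P x * (\1_D t * expR (- (t * x))))%:E) =
  (\1_D t)%:E * \int[mu]_(x in P) (f x * expR (- (t * x)))%:E.
Proof.
rewrite [in RHS]integral_mkcond -ge0_integralZl ?lee_fin//; first last.
- by move=> x _; rewrite patchE; case: ifP => // _; rewrite lee_fin mulr_ge0 ?expR_ge0.
- apply/(measurable_restrictT _ _).1 => //; apply: measurable_funTS.
  by apply/measurable_EFinP; apply: measurable_funM => //; exact: measurable_expR_kernel'.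
apply: eq_integral => x _; rewrite -EFinM patchE !indicE.
case: (x \in P); last by rewrite /= mul0r mulr0 mule0.
by rewrite /= mul1r -EFinM mulrCA.
Qed.

Lemma measurable_inner_laplace :
  measurable_fun D (fun t => \int[mu]_(x in P) (f x * expR (- (t * x)))%:E).
Proof.
have H := @measurable_fun_fubini_tonelli_G _ _ _ _ R mu _ mfker fker0.
rewrite /fubini_G /= in H.
apply: (eq_measurable_fun (fun t => (\1_D t)%:E * \int[mu]_(x in P) (f x * expR (- (t * x)))%:E)).
  by move=> t tD; rewrite indicE tD mul1e.
apply: measurable_funTS; apply: (eq_measurable_fun _ (fun t _ => inner2 t)).
exact: H.
Qed.

Lemma laplace_tonelli :
  \int[mu]_x ((f x)%:E * ((\1_P x)%:E * \int[G]_(t in D) (expR (- (t * x)))%:E)) =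
  \int[G]_(t in D) \int[mu]_(x in P) (f x * expR (- (t * x)))%:E.
Proof.
have := @fubini_tonelli _ _ _ _ R mu G _ mfker fker0.
rewrite /= => H.
transitivity (\int[G]_t ((\1_D t)%:E * \int[mu]_(x in P) (f x * expR (- (t * x)))%:E)).
  rewrite -(eq_integral _ _ (fun t _ => inner2 t)) -H.
  apply: eq_integral => x _; rewrite -inner ge0_integralZl//.
  - exact: (measurableT_comp mker (pair1_measurable x)).
  - by rewrite lee_fin.
rewrite [RHS]integral_mkcond; apply: eq_integral => t _.
by rewrite patchE indicE; case: (t \in D); rewrite /= ?mul1e ?mul0e.
Qed.

End laplace_tonelli.

(** * Integration against the Levy measure of an SL process *)

Section sigma_finite_copy.
Context d (T : measurableType d) (R : realType).
Variables (m : {measure set T -> \bar R}) (sm : sigma_finite setT m).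

(* The argument [sm] lets canonical structure inference find sigma-finiteness. *)
Definition sigma_finite_copy of sigma_finite setT m : set T -> \bar R := m.

HB.instance Definition _ := Measure.copy (sigma_finite_copy sm) m.

HB.instance Definition _ :=
  @Measure_isSigmaFinite.Build _ _ _ (sigma_finite_copy sm) sm.

End sigma_finite_copy.

(** The point 0 is left out even for m = 0, because 1/t enters the kernels. *)
Definition above (R : realType) (m : R) : set R := [set t | 0 < t /\ m <= t].

Lemma aboveE (R : realType) (m : R) :
  above m = `]0, +oo[%classic `&` `[m, +oo[%classic.
Proof. by apply/seteqP; split => t /=; rewrite !in_itv/= !andbT. Qed.

Lemma measurable_above (R : realType) (m : R) : measurable (above m).
Proof. by rewrite aboveE; exact: measurableI. Qed.

(** * Sigma-finiteness and support of SL-measures *)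

Section SLM_theory.
Local Open Scope ereal_scope.
Variables (R : realType) (m : R) (G : {measure set R -> \bar R}).
Hypothesis SLM_G : SLM m G.

(** A compact exhaustion of (0, +oo), on each member of which the weights of [SLM] and [SM] are
    bounded below by a positive constant. *)
Let I (n : nat) : set R := `[n.+1%:R^-1%R, n.+1%:R%R]%classic.

Let mI n : measurable (I n). Proof. by rewrite /I; exact: measurable_itv. Qed.

Let cover_I : `]0%R, +oo[%classic = \bigcup_n I n :> set R.
Proof.
apply/seteqP; split => t /=; rewrite in_itv/= ?andbT.
- move=> t0; pose k := Num.truncn (t + t^-1)%R.
  have ti0 : (0 < t^-1)%R by rewrite invr_gt0.
  have kt : (t + t^-1 < k.+1%:R)%R by exact: truncnS_gt.
  exists k => //; rewrite /I/= in_itv/=; apply/andP; split; last by lra.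
  have k0 : (0 < k.+1%:R :> R)%R by rewrite ltr0n.
  by rewrite -[leRHS]invrK lef_pV2 ?posrE//; lra.
- by move=> [n _]; rewrite /I/= in_itv/= => /andP[+ _]; apply: lt_le_trans; rewrite invr_gt0.
Qed.

Let I_pos n t : I n t -> (0 < t)%R.
Proof.
by rewrite /I/= in_itv/= => /andP[+ _]; apply: lt_le_trans; rewrite invr_gt0.
Qed.

(** H has density 1/w with respect to G, and w is nondecreasing, so on [I n] the density is at least
    1/w(n+1). This carries finiteness and null sets from H to G. *)
Let SLM_bound : exists H : {measure set R -> \bar R}, SM m H /\
  forall n, exists2 e : R, (0 < e)%R &
  forall A, measurable A -> e%:E * G (A `&` I n) <= H (A `&` I n).
Proof.
case: SLM_G => _ [a2 [a1 [H [a20 a10 a0 HE SMH]]]]; exists H; split => // n.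
pose w (t : R) : R := (a2 * t ^+ 2 + a1 * t)%R.
have w0 (t : R) : (0 < t)%R -> (0 < w t)%R.
  move=> t0; rewrite /w; have := exprn_gt0 2 t0 => t20.
  have [a2p|] := ltP 0%R a2; first by nra.
  by move=> a2n; have -> : a2 = 0%R by [lra]; nra.
have n0 : (0 < n.+1%:R :> R)%R by rewrite ltr0n.
exists (w n.+1%:R)^-1%R; first by rewrite invr_gt0 w0.
move=> A mA; have mAI : measurable (A `&` I n) by exact: measurableI.
rewrite HE// (_ : A `&` I n `&` _ = A `&` I n); last first.
  by apply/setIidPl => t [_ /I_pos]; rewrite /= in_itv/= andbT.
rewrite -integral_cst//; apply: ge0_le_integral => //.
- by move=> t _; rewrite lee_fin invr_ge0 ltW// w0.
- apply/measurable_EFinP; apply: measurable_funTS; apply: measurable_funV.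
  by apply: measurable_funD; apply: measurable_funM => //; exact: exprn_measurable.
- move=> t [_ It]; have t0 := I_pos It; rewrite lee_fin lef_pV2 ?posrE ?w0//.
  move: It; rewrite /I/= in_itv/= => /andP[_ tn].
  rewrite /w lerD// ler_wpM2l//.
  by rewrite lerXn2r ?nnegrE// ltW.
Qed.

Lemma SLM_sigma_finite : sigma_finite setT G.
Proof.
have [H [[_ SMH _] bound]] := SLM_bound.
have G0 : G `]-oo, 0%R]%classic = 0 by case: SLM_G.
(* The null half-line is added to every set so that the cover is the whole line. *)
exists (fun n => `]-oo, 0%R]%classic `|` I n).
  rewrite bigcupUr; last by exists 0%N.
  rewrite -cover_I; apply/seteqP; split => // t _ /=.
  by have [t0|t0] := leP t 0%R; [left|right]; rewrite in_itv/= ?andbT.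
move=> n; split; first exact: measurableU.
apply: (@le_lt_trans _ _ (G `]-oo, 0%R]%classic + G (I n))).
  exact: measureU2.
rewrite G0 add0e.
have [e e0 /(_ setT measurableT)] := bound n; rewrite setTI => eG.
have HI : H (I n) < +oo.
  (* Markov's inequality: the integrand 1/(1 + t) of [SM] is at least 1/c on [I n]. *)
  pose c : R := (1 + n.+1%:R)%R.
  have c0 : (0 < c)%R by rewrite ltr_pwDl// ler0n.
  have : c^-1%:E * H (I n) <= \int[H]_(t in `]0%R, +oo[) ((1 + t)^-1)%:E.
    rewrite -integral_cst//.
    apply: (@le_trans _ _ (\int[H]_(t in I n) ((1 + t)^-1)%:E)).
      apply: ge0_le_integral => //.
      - by move=> t _; rewrite lee_fin invr_ge0 ltW.
      - apply/measurable_EFinP; apply: measurable_funTS; apply: measurable_funV.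
        exact: measurable_funD.
      - move=> t It; have t0 := I_pos It; rewrite lee_fin lef_pV2 ?posrE//; last by lra.
        by move: It; rewrite /I/= in_itv/= /c => /andP[_]; lra.
    apply: ge0_subset_integral => //.
    - apply/measurable_EFinP; apply: measurable_funTS; apply: measurable_funV.
      exact: measurable_funD.
    - by move=> t /=; rewrite in_itv/= andbT => t0; rewrite lee_fin invr_ge0; lra.
    - by move=> t /I_pos; rewrite /= in_itv/= andbT.
  move=> /le_lt_trans/(_ SMH).
  have : 0 <= H (I n) by [].
  case: (H (I n)) => [r _ _|_|//]; first exact: ltry.
  by rewrite gt0_muley// lte_fin invr_gt0.
have := le_lt_trans eG HI.
have : 0 <= G (I n) by [].
case: (G (I n)) => [r _ _|_|//]; first exact: ltry.
by rewrite gt0_muley// lte_fin.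
Qed.

(** The support condition is imposed on H; it passes to G on each [I n], then to the countable
    union. *)
Lemma SLM_null : G `]-oo, m[%classic = 0.
Proof.
have [H [[_ _ Hm] bound]] := SLM_bound.
have G0 : G `]-oo, 0%R]%classic = 0 by case: SLM_G.
have mm : measurable (`]-oo, m[%classic : set R) by [].
have mmI n : measurable (`]-oo, m[%classic `&` I n) by exact: measurableI.
apply/eqP; rewrite eq_le measure_ge0 andbT.
have sub : `]-oo, m[%classic `<=`
    `]-oo, 0%R]%classic `|` \bigcup_n (`]-oo, m[%classic `&` I n).
  rewrite -setI_bigcupr -cover_I => t /= tm.
  by have [t0|t0] := leP t 0%R; [left|right; split]; rewrite //= in_itv/= ?andbT.
have mU : measurable (\bigcup_n (`]-oo, m[%classic `&` I n)) by exact: bigcupT_measurable.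
apply: le_trans (le_measure _ _ _ sub) _; rewrite ?inE//; first exact: measurableU.
apply: (@le_trans _ _ (G `]-oo, 0%R]%classic +
    G (\bigcup_n (`]-oo, m[%classic `&` I n)))); first exact: measureU2.
rewrite G0 add0e.
have /negligible_bigcup : forall n, G.-negligible (`]-oo, m[%classic `&` I n).
  move=> n; apply/negligibleP => //.
  have [e e0 /(_ _ mm) eG] := bound n.
  have : e%:E * G (`]-oo, m[%classic `&` I n) <= 0.
    by apply: le_trans eG _; rewrite -Hm; apply: le_measure; rewrite ?inE//; apply: subIset; left.
  rewrite pmule_rle0// => Gn.
  by apply/eqP; rewrite eq_le Gn measure_ge0.
by move=> /(negligibleP _ mU) ->.
Qed.

Lemma SLM_integral_above (f : R -> \bar R) :
  measurable_fun setT f -> (forall t, (0 < t)%R -> 0 <= f t) ->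
  \int[G]_(t in `]0%R, +oo[) f t = \int[G]_(t in above m) f t.
Proof.
move=> mf f0; rewrite (@ge0_negligible_integral _ _ _ G _ `]-oo, m[%classic)//.
- congr integral; apply/seteqP; split => t /=; rewrite /above/= !in_itv/= andbT.
    by move=> [t0 /negP]; rewrite -leNgt.
  by move=> [t0 mt]; split => //; apply/negP; rewrite -leNgt.
- exact: measurable_funTS.
- by move=> t /=; rewrite in_itv/= andbT; exact: f0.
- exact: SLM_null.
Qed.

End SLM_theory.

Section SL_measure.
Local Open Scope ereal_scope.
Variables (R : realType) (mum mup : R) (F Gm Gp : {measure set R -> \bar R}).
Hypotheses (SLM_Gm : SLM mup Gm) (SLM_Gp : SLM (- mum) Gp).
Hypothesis FE : forall A : set R, measurable A ->
  F A = \int[lebesgue_measure]_(x in A) SL_density Gm Gp x.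
Local Notation mu := (@lebesgue_measure R).
Local Notation P := (`]0%R, +oo[%classic : set R).

Lemma ge0_integral_oppr (g : R -> \bar R) : measurable_fun setT g ->
  (forall x, 0 <= g x) -> \int[mu]_x g (- x)%R = \int[mu]_x g x.
Proof.
move=> mg g0; transitivity (\int[pushforward mu (-%R : _ -> measurableTypeR R)]_x g x).
  by rewrite ge0_integral_pushforward//; exact: oppr_measurable.
by apply: eq_measure_integral => A mA _; exact: lebesgue_measureN.
Qed.

Lemma measurable_funN_arg d (T : measurableType d) (g : R -> T) :
  measurable_fun setT g -> measurable_fun setT (fun x : R => g (- x)%R).
Proof. by move=> mg; apply: (measurableT_comp mg); exact: oppr_measurable. Qed.

(** The negative half-line is reflected, so that both parts of the density become Laplace transforms
    on (0, +oo) and Tonelli applies to each. All integrals stay extended real, finiteness being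
    unknown here. *)
Lemma SL_measure_integral (f : R -> R) :
  measurable_fun setT f -> (forall x, (0 <= f x)%R) ->
  \int[F]_x (f x)%:E =
  \int[Gm]_(t in above mup) \int[mu]_(x in P) (f (- x)%R * expR (- (t * x)))%:E +
  \int[Gp]_(t in above (- mum)) \int[mu]_(x in P) (f x * expR (- (t * x)))%:E.
Proof.
move=> mf f0.
pose Gm' : {sigma_finite_measure set R -> \bar R} :=
  sigma_finite_copy (SLM_sigma_finite SLM_Gm).
pose Gp' : {sigma_finite_measure set R -> \bar R} :=
  sigma_finite_copy (SLM_sigma_finite SLM_Gp).
have mA (m : R) := measurable_above m.
pose Lm x := (\1_P x)%:E * \int[Gm']_(t in above mup) (expR (- (t * x)))%:E.
pose Lp x := (\1_P x)%:E * \int[Gp']_(t in above (- mum)) (expR (- (t * x)))%:E.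
have mLm : measurable_fun setT Lm by exact: measurable_laplace.
have mLp : measurable_fun setT Lp by exact: measurable_laplace.
have Lm0 x : 0 <= Lm x.
  by rewrite mule_ge0 ?lee_fin//; apply: integral_ge0 => t _; rewrite lee_fin expR_ge0.
have Lp0 x : 0 <= Lp x.
  by rewrite mule_ge0 ?lee_fin//; apply: integral_ge0 => t _; rewrite lee_fin expR_ge0.
have mexp x : measurable_fun setT (fun t : R => (expR (t * x))%:E).
  by apply/measurable_EFinP; apply: measurableT_comp => //; exact: measurable_funM.
have densE x : SL_density Gm Gp x = Lm (- x)%R + Lp x.
  rewrite /SL_density /Lm /Lp; congr (_ * _ + _ * _).
  - by rewrite !indicE !mem_setE !in_itv/= andbT oppr_gt0.
  - rewrite (SLM_integral_above SLM_Gm (mexp x)).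
      by under [RHS]eq_integral do rewrite mulrN opprK.
    by move=> t _; rewrite lee_fin expR_ge0.
  - rewrite (SLM_integral_above SLM_Gp)//.
      by apply: (eq_measurable_fun _ _ (mexp (- x)%R)) => t _; rewrite mulrN.
have TP : \int[mu]_x ((f x)%:E * Lp x) =
    \int[Gp]_(t in above (- mum)) \int[mu]_(x in P) (f x * expR (- (t * x)))%:E.
  exact: (@laplace_tonelli _ Gp').
have TM : \int[mu]_x ((f (- x)%R)%:E * Lm x) =
    \int[Gm]_(t in above mup) \int[mu]_(x in P) (f (- x)%R * expR (- (t * x)))%:E.
  apply: (@laplace_tonelli _ Gm' _ (mA mup) (fun x => f (- x)%R)) => //.
  exact: measurable_funN_arg.
rewrite -TP -TM; move: mLm mLp Lm0 Lp0 densE.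
move: (Lm) (Lp) => {TP TM Lm Lp} Lm Lp mLm mLp Lm0 Lp0 densE.
have mf' : measurable_fun [set: measurableTypeR R] (EFin \o f).
  exact/measurable_EFinP.
have mLm' : measurable_fun [set: measurableTypeR R] Lm by exact: mLm.
have mLp' : measurable_fun [set: measurableTypeR R] Lp by exact: mLp.
have mN : measurable_fun [set: measurableTypeR R] (-%R : R -> measurableTypeR R).
  exact: oppr_measurable.
have mLmN : measurable_fun [set: measurableTypeR R] (fun x => Lm (- x)%R).
  exact: (measurableT_comp mLm' mN).
have -> : \int[F]_x (f x)%:E = \int[mu]_x ((f x)%:E * (Lm (- x)%R + Lp x)).
  (* [R] and [measurableTypeR R] carry the same sets under different displays. *)
  apply: (@ge0_integral_density_comp _ _ R (measurableTypeR R) R mu F id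
            (fun x : R => Lm (- x)%R + Lp x) f).
  - by move=> _ A mB; rewrite setTI.
  - exact: emeasurable_funD.
  - by move=> x; rewrite adde_ge0.
  - by move=> A mA'; rewrite FE//; apply: eq_integral => x _; rewrite densE.
  - exact: mf.
  - exact: f0.
under eq_integral do rewrite ge0_muleDr//.
have -> : \int[mu]_x ((f (- x)%R)%:E * Lm x) = \int[mu]_x ((f x)%:E * Lm (- x)%R).
  rewrite -(@ge0_integral_oppr (fun x => (f (- x)%R)%:E * Lm x)).
  - by apply: eq_integral => x _; rewrite opprK.
  - by apply: emeasurable_funM => //; exact: (measurableT_comp mf' mN).
  - by move=> x; rewrite mule_ge0 ?lee_fin.
apply: ge0_integralD => //.
- by move=> x _; rewrite mule_ge0 ?lee_fin.
- exact: emeasurable_funM.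
- by move=> x _; rewrite mule_ge0 ?lee_fin.
- exact: emeasurable_funM.
Qed.

End SL_measure.

(** * Explicit Laplace transforms *)

Section laplace_transforms.
Variable R : realType.
Local Notation mu := (@lebesgue_measure R).
Local Notation P := (`]0%R, +oo[%classic : set R).

Lemma cvg_expRN_mul_bounded (t K : R) (g : R -> R) : 0 < t ->
  (forall x, `|g x| <= K) -> expR (- (t * x)) * g x @[x --> +oo] --> (0 : R).
Proof.
move=> t0 gK.
have c0 : expR (- (t * x)) @[x --> +oo] --> (0 : R).
  apply: (@cvg_comp _ _ _ (fun x => t * x) (fun y => expR (- y)) _ (pinfty_nbhs R));
    last exact: cvgr_expR.
  exact: gt0_cvgMry.
have cK : K * expR (- (t * x)) @[x --> +oo] --> (0 : R).
  by rewrite -(mulr0 K); exact: cvgMr.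
have cNK : - (K * expR (- (t * x))) @[x --> +oo] --> (0 : R).
  by rewrite -oppr0; exact: cvgN.
apply: (squeeze_cvgr _ cNK cK); apply: nearW => x.
have := gK x; rewrite ler_norml => /andP[g1 g2].
have := expR_ge0 (- (t * x)) => e0.
by rewrite -mulNr ![_ * expR _]mulrC !ler_wpM2l.
Qed.

Lemma is_derive_mull (k x : R) : is_derive x 1 (fun y : R => k * y) k.
Proof.
apply: is_derive_eq (is_deriveZ k (is_derive_id x 1)) _.
by rewrite /GRing.scale /= mulr1.
Qed.

Lemma is_derive_trig (xi a b c x : R) :
  is_derive x 1 (fun y => c + a * cos (xi * y) + b * sin (xi * y))
    (b * xi * cos (xi * x) - a * xi * sin (xi * x)).
Proof.
have dxi := is_derive_mull xi x.
have dc := is_deriveZ a (@is_derive1_comp _ cos _ x _ _ (is_derive_cos (xi * x)) dxi).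
have ds := is_deriveZ b (@is_derive1_comp _ sin _ x _ _ (is_derive_sin (xi * x)) dxi).
apply: is_derive_eq (is_deriveD (is_deriveD (is_derive_cst c x 1) dc) ds) _.
by rewrite /GRing.scale /=; ring.
Qed.

Lemma is_derive_expRN_mul (t x : R) (g : R -> R) (g' : R) : is_derive x 1 g g' ->
  is_derive x 1 (fun y => expR (- (t * y)) * g y) ((g' - t * g x) * expR (- (t * x))).
Proof.
move=> dg.
have de := @is_derive1_comp _ expR (fun y => - (t * y)) x _ _
  (is_derive_expR (- (t * x))) (is_deriveN (is_derive_mull t x)).
apply: is_derive_eq (is_deriveM de dg) _.
by rewrite /GRing.scale /=; ring.
Qed.

(** The integrand is the derivative of exp(-tx) (c + a cos(xi x) + b sin(xi x)), which vanishes at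
    +oo. The free coefficients allow one to prescribe f; its sign is what the fundamental theorem on
    a half-line asks for. *)
Lemma expR_trig_integral (t xi a b c : R) : 0 < t ->
  let f x := - (t * c) + (b * xi - t * a) * cos (xi * x)
             + (- (a * xi) - t * b) * sin (xi * x) in
  (forall x, 0 <= f x) ->
  (\int[mu]_(x in P) (f x * expR (- (t * x)))%:E = (- (c + a))%:E)%E.
Proof.
move=> t0 f f0.
pose F x := expR (- (t * x)) * (c + a * cos (xi * x) + b * sin (xi * x)).
have dF (x : R) : is_derive x 1 F (f x * expR (- (t * x))).
  apply: is_derive_eq (is_derive_expRN_mul t (is_derive_trig xi a b c x)) _.
  by rewrite /f; ring.
have cts (h : R -> R) : (forall x, derivable h x 1) -> continuous h.
  by move=> dh x; apply: differentiable_continuous; apply/derivable1_diffP; exact: dh.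
have cf : continuous (fun x => f x * expR (- (t * x))).
  rewrite (_ : (fun x => _) = (fun x => expR (- (t * x)) * f x)); last first.
    by apply/funext => x; rewrite mulrC.
  apply: cts => x.
  have [df] := is_derive_expRN_mul t (is_derive_trig xi (b * xi - t * a)
    (- (a * xi) - t * b) (- (t * c)) x); by [].
rewrite integral_itv_obnd_cbnd; last first.
  apply/measurable_EFinP; apply: measurable_funTS.
  exact: continuous_measurable_fun.
rewrite (@ge0_continuous_FTC2y _ _ F _ 0).
- by rewrite /F mulr0 oppr0 expR0 mulr0 cos0 sin0 mulr0 addr0 !mulr1 mul1r sub0e.
- by move=> x _; rewrite mulr_ge0 ?expR_ge0.
- exact: continuous_subspaceT.
- apply: (@cvg_expRN_mul_bounded t (`|c| + `|a| + `|b|)) => // x.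
  apply: le_trans (ler_normD _ _) _; apply: lerD.
    apply: le_trans (ler_normD _ _) _; apply: lerD => //.
    by rewrite normrM ler_piMr// ler_norml cos_geN1 cos_le1.
  by rewrite normrM ler_piMr// ler_norml sin_geN1 sin_le1.
- by move=> x _; exact: ex_derive.
- by apply: cvg_at_right_filter; apply: cts => x; exact: ex_derive.
- by move=> x _; rewrite derive1E; exact: derive_val.
Qed.

Lemma expR_integral (t : R) : 0 < t ->
  (\int[mu]_(x in P) (expR (- (t * x)))%:E = (t^-1)%:E)%E.
Proof.
move=> t0; have := @expR_trig_integral t 0 0 0 (- t^-1) t0.
rewrite /= => H.
have E x : - (t * - t^-1) + (0 * 0 - t * 0) * cos (0 * x) + (- (0 * 0) - t * 0) * sin (0 * x) = 1 :> R.
  by field; rewrite gt_eqF.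
rewrite addr0 opprK in H; rewrite -H; last by move=> x; rewrite E.
by under [RHS]eq_integral do rewrite E mul1r.
Qed.

Lemma expR_1Bcos_integral (t xi : R) : 0 < t ->
  (\int[mu]_(x in P) ((1 - cos (xi * x)) * expR (- (t * x)))%:E =
   (t^-1 - t / (t ^+ 2 + xi ^+ 2))%:E)%E.
Proof.
move=> t0; have d0 : 0 < t ^+ 2 + xi ^+ 2 by rewrite ltr_pwDl ?sqr_ge0 ?exprn_gt0.
(* These coefficients solve b xi - t a = -1, a xi + t b = 0 and - t c = 1, so that f is 1 - cos. *)
have := @expR_trig_integral t xi (t / (t ^+ 2 + xi ^+ 2)) (- xi / (t ^+ 2 + xi ^+ 2)) (- t^-1) t0.
rewrite /= => H.
pose d := t ^+ 2 + xi ^+ 2.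
have E x : - (t * - t^-1) + (- xi / d * xi - t * (t / d)) * cos (xi * x) +
    (- (t / d * xi) - t * (- xi / d)) * sin (xi * x) = 1 - cos (xi * x).
  by rewrite /d; field; rewrite !gt_eqF.
rewrite (_ : t^-1 - _ = - (- t^-1 + t / d)); last by rewrite /d; ring.
rewrite -H; last by move=> x; rewrite E subr_ge0 cos_le1.
by under [RHS]eq_integral do rewrite E.
Qed.

(** The sine changes sign, but 1 - sin does not; [laplace_sin] recovers the sine by linearity. *)
Lemma expR_1Bsin_integral (t xi : R) : 0 < t ->
  (\int[mu]_(x in P) ((1 - sin (xi * x)) * expR (- (t * x)))%:E =
   (t^-1 - xi / (t ^+ 2 + xi ^+ 2))%:E)%E.
Proof.
move=> t0; have d0 : 0 < t ^+ 2 + xi ^+ 2 by rewrite ltr_pwDl ?sqr_ge0 ?exprn_gt0.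
have := @expR_trig_integral t xi (xi / (t ^+ 2 + xi ^+ 2)) (t / (t ^+ 2 + xi ^+ 2)) (- t^-1) t0.
rewrite /= => H.
pose d := t ^+ 2 + xi ^+ 2.
have E x : - (t * - t^-1) + (t / d * xi - t * (xi / d)) * cos (xi * x) +
    (- (xi / d * xi) - t * (t / d)) * sin (xi * x) = 1 - sin (xi * x).
  by rewrite /d; field; rewrite !gt_eqF.
rewrite (_ : t^-1 - _ = - (- t^-1 + xi / d)); last by rewrite /d; ring.
rewrite -H; last by move=> x; rewrite E subr_ge0 sin_le1.
by under [RHS]eq_integral do rewrite E.
Qed.

End laplace_transforms.

Section laplace.
Variable R : realType.
Local Notation mu := (@lebesgue_measure R).
Local Notation P := (`]0%R, +oo[%classic : set R).
Implicit Types (u v : R -> R) (t K : R).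

Definition laplace u t : R := \int[mu]_(x in P) (u x * expR (- (t * x))).

Lemma laplace_integrable u t K : 0 < t -> measurable_fun setT u ->
  (forall x, `|u x| <= K) ->
  mu.-integrable P (fun x => (u x * expR (- (t * x)))%:E).
Proof.
move=> t0 mu' uK; have mexp : measurable_fun setT (fun x : R => expR (- (t * x))).
  apply: measurableT_comp => //; apply: measurable_funN.
  exact: measurable_funM.
apply: (@le_integrable _ _ _ mu _ _ _ (fun x => K%:E * (expR (- (t * x)))%:E)%E) => //.
- apply/measurable_EFinP; apply: measurable_funTS; exact: measurable_funM.
- move=> x _; rewrite -EFinM !abse_EFin lee_fin !normrM.
  by rewrite ler_wpM2r// (le_trans (uK x))// ler_norm.
- apply: integrableZl => //; apply/integrableP; split.
    by apply/measurable_EFinP; exact: measurable_funTS.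
  under eq_integral do rewrite gee0_abs ?lee_fin ?expR_ge0//.
  by rewrite expR_integral// ltry.
Qed.

Lemma laplaceE u t K : 0 < t -> measurable_fun setT u ->
  (forall x, `|u x| <= K) ->
  (\int[mu]_(x in P) (u x * expR (- (t * x)))%:E = (laplace u t)%:E)%E.
Proof.
move=> t0 mu' uK; rewrite /laplace /Rintegral fineK//.
by apply: integrable_fin_num => //; exact: laplace_integrable uK.
Qed.

Lemma laplaceB u v t K : 0 < t -> measurable_fun setT u -> measurable_fun setT v ->
  (forall x, `|u x| <= K) -> (forall x, `|v x| <= K) ->
  laplace (fun x => u x - v x) t = laplace u t - laplace v t.
Proof.
move=> t0 mu' mv uK vK; rewrite /laplace -RintegralB//.
- by apply: eq_Rintegral => x _; rewrite mulrBl.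
- exact: laplace_integrable uK.
- exact: laplace_integrable vK.
Qed.

Lemma laplaceZ u t K k : 0 < t -> measurable_fun setT u ->
  (forall x, `|u x| <= K) -> laplace (fun x => k * u x) t = k * laplace u t.
Proof.
move=> t0 mu' uK; rewrite /laplace -RintegralZl//.
- by apply: eq_Rintegral => x _; rewrite mulrA.
- exact: laplace_integrable uK.
Qed.

Lemma laplace1 t : 0 < t -> laplace (fun=> 1) t = t^-1.
Proof.
move=> t0; rewrite /laplace /Rintegral.
by under eq_integral do rewrite mul1r; rewrite expR_integral.
Qed.

Lemma laplace_1Bcos t xi : 0 < t ->
  laplace (fun x => 1 - cos (xi * x)) t = t^-1 - t / (t ^+ 2 + xi ^+ 2).
Proof. by move=> t0; rewrite /laplace /Rintegral expR_1Bcos_integral. Qed.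

Lemma measurable_sin_mul xi : measurable_fun setT (fun x : R => sin (xi * x)).
Proof.
apply: measurableT_comp; first exact: continuous_measurable_fun (@continuous_sin R).
exact: measurable_funM.
Qed.

Lemma measurable_cos_mul xi : measurable_fun setT (fun x : R => cos (xi * x)).
Proof.
apply: measurableT_comp; first exact: continuous_measurable_fun (@continuous_cos R).
exact: measurable_funM.
Qed.

Lemma norm_sin_le1 (x : R) : `|sin x| <= 1.
Proof. by rewrite ler_norml sin_geN1 sin_le1. Qed.

Lemma laplace_sin t xi : 0 < t ->
  laplace (fun x => sin (xi * x)) t = xi / (t ^+ 2 + xi ^+ 2).
Proof.
move=> t0; have -> : (fun x => sin (xi * x)) = (fun x => 1 - (1 - sin (xi * x))).
  by apply/funext => x; ring.
have ms := measurable_sin_mul xi.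
rewrite (@laplaceB _ _ _ 2)//.
- rewrite laplace1// [X in _ - X](_ : _ = t^-1 - xi / (t ^+ 2 + xi ^+ 2)); first by ring.
  by rewrite /laplace /Rintegral expR_1Bsin_integral.
- exact: measurable_funB.
- by move=> x; rewrite normr1; lra.
- by move=> x; have := norm_sin_le1 (xi * x); rewrite ler_norml => /andP[? ?];
    rewrite ler_norml; apply/andP; split; lra.
Qed.

Lemma measurable_laplace_transform u K (D : set R) : measurable D -> (forall t, D t -> 0 < t) ->
  measurable_fun setT u -> (forall x, 0 <= u x <= K) ->
  measurable_fun D (laplace u).
Proof.
move=> mD D0 mu' uK; apply/measurable_EFinP.
apply: (eq_measurable_fun (fun t => \int[mu]_(x in P) (u x * expR (- (t * x)))%:E)%E).
  move=> t /set_mem/D0 t0; rewrite (@laplaceE _ _ K)// => x.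
  by have /andP[u0 uk] := uK x; rewrite ger0_norm.
by apply: measurable_inner_laplace => // x; case/andP: (uK x).
Qed.

End laplace.

(** * Lévy integrals of signed functions as integrals of Laplace transforms *)

Section levy_integral.
Variables (R : realType) (mum mup : R) (F Gm Gp : {measure set R -> \bar R}).
Hypotheses (SLM_Gm : SLM mup Gm) (SLM_Gp : SLM (- mum) Gp).
Hypothesis FE : forall A : set R, measurable A ->
  F A = (\int[lebesgue_measure]_(x in A) SL_density Gm Gp x)%E.
Hypothesis levyF : is_levy_measure F.
Local Notation mu := (@lebesgue_measure R).
Local Notation P := (`]0%R, +oo[%classic : set R).
Local Notation m x := (Num.min 1 (x ^+ 2)).

(** The integrabilities are bundled with the identity to let it pass to differences. *)
Definition SL_integral_formula (u : R -> R) : Prop :=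
  [/\ F.-integrable setT (EFin \o u),
      Gm.-integrable (above mup) (EFin \o laplace (fun x : R => u (- x))),
      Gp.-integrable (above (- mum)) (EFin \o laplace u) &
      \int[F]_x u x = \int[Gm]_(t in above mup) laplace (fun x : R => u (- x)) t +
                      \int[Gp]_(t in above (- mum)) laplace u t].

Lemma above_gt0 (b t : R) : above b t -> 0 < t. Proof. by case. Qed.

Lemma laplace_ge0 (u : R -> R) t : (forall x, 0 <= u x) -> 0 <= laplace u t.
Proof. by move=> u0; apply: Rintegral_ge0 => x _; rewrite mulr_ge0 ?expR_ge0. Qed.

(** The Lévy measure makes the left side of [SL_measure_integral] finite; both summands on the right
    are non-negative, hence finite too. *)
Let SL_integral_ge0 (v : R -> R) K : measurable_fun setT v ->
  (forall x, 0 <= v x <= K * m x) -> SL_integral_formula v.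
Proof.
move=> mv vK.
have v0 x : 0 <= v x by case/andP: (vK x).
have K0 : 0 <= K.
  have /andP[/le_trans/[apply]] := vK 1.
  by rewrite expr1n minxx mulr1.
have m1 (x : R) : 0 <= m x <= 1.
  by rewrite ge_min lexx andbT le_min ler01 sqr_ge0.
have vK' x : 0 <= v x <= K.
  have /andP[v0' /le_trans->//] := vK x; first by rewrite v0'.
  by have /andP[? ?] := m1 x; rewrite ler_piMr.
have vabs x : `|v x| <= K by have /andP[? ?] := vK' x; rewrite ger0_norm.
have mvN : measurable_fun setT (fun x : R => v (- x)) by exact: measurable_funN_arg.
have mm : measurable_fun setT (fun x : R => m x).
  by apply: measurable_minr => //; exact: exprn_measurable.
have intF : (\int[F]_x (v x)%:E < +oo)%E.
  case: levyF => _ Fm.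
  apply: (@le_lt_trans _ _ (\int[F]_x (K%:E * (m x)%:E))%E).
    apply: ge0_le_integral => //.
    - by move=> x _; rewrite lee_fin.
    - exact/measurable_EFinP.
    - by apply: measurable_funeM; exact/measurable_EFinP.
    - by move=> x _; rewrite -EFinM lee_fin; case/andP: (vK x).
  rewrite ge0_integralZl//; first exact: lte_mul_pinfty.
  - exact/measurable_EFinP.
  - by move=> x _; rewrite lee_fin; case/andP: (m1 x).
have E := SL_measure_integral SLM_Gm SLM_Gp FE mv v0.
have Em : (\int[Gm]_(t in above mup) \int[mu]_(x in P) (v (- x) * expR (- (t * x)))%:E =
    \int[Gm]_(t in above mup) (laplace (fun x : R => v (- x)) t)%:E)%E.
  apply: eq_integral => t /set_mem[t0 _].
  by rewrite (@laplaceE _ _ _ K).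
have Ep : (\int[Gp]_(t in above (- mum)) \int[mu]_(x in P) (v x * expR (- (t * x)))%:E =
    \int[Gp]_(t in above (- mum)) (laplace v t)%:E)%E.
  apply: eq_integral => t /set_mem[t0 _].
  by rewrite (@laplaceE _ _ _ K).
rewrite {}Em {}Ep in E.
have Lm0 t := laplace_ge0 t (fun x => v0 (- x)).
have Lp0 t := laplace_ge0 t v0.
have Im0 : (0 <= \int[Gm]_(t in above mup) (laplace (fun x : R => v (- x)) t)%:E)%E.
  by apply: integral_ge0 => t _; rewrite lee_fin.
have Ip0 : (0 <= \int[Gp]_(t in above (- mum)) (laplace v t)%:E)%E.
  by apply: integral_ge0 => t _; rewrite lee_fin.
have Imf : (\int[Gm]_(t in above mup) (laplace (fun x : R => v (- x)) t)%:E < +oo)%E.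
  by apply: le_lt_trans intF; rewrite E leeDl.
have Ipf : (\int[Gp]_(t in above (- mum)) (laplace v t)%:E < +oo)%E.
  by apply: le_lt_trans intF; rewrite E leeDr.
have mA (b : R) := @measurable_above R b.
split.
- apply/integrableP; split; first exact/measurable_EFinP.
  by under eq_integral do rewrite gee0_abs ?lee_fin//.
- apply/integrableP; split.
    apply/measurable_EFinP; apply: (@measurable_laplace_transform _ _ K) => //.
    by move=> t [].
  by under eq_integral do rewrite gee0_abs ?lee_fin//.
- apply/integrableP; split.
    apply/measurable_EFinP; apply: (@measurable_laplace_transform _ _ K) => //.
    by move=> t [].
  by under eq_integral do rewrite gee0_abs ?lee_fin//.
- by rewrite /Rintegral E fineD// ge0_fin_numE.
Qed.

(** Writing u = (u + K min(1, x^2)) - K min(1, x^2) gives two non-negative functions dominated by 2K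
    and K times min(1, x^2). *)
Lemma SL_integral (u : R -> R) K : measurable_fun setT u ->
  (forall x, `|u x| <= K * m x) -> SL_integral_formula u.
Proof.
move=> mu' uK.
have m1 (x : R) : 0 <= m x <= 1.
  by rewrite ge_min lexx andbT le_min ler01 sqr_ge0.
have K0 : 0 <= K.
  have := le_trans (normr_ge0 _) (uK 1).
  by rewrite expr1n minxx mulr1.
have mm : measurable_fun setT (fun x : R => m x).
  by apply: measurable_minr => //; exact: exprn_measurable.
pose v x := u x + K * m x; pose w x := K * m x.
have vw : u = (fun x => v x - w x) by apply/funext => x; rewrite /v /w addrK.
have mw : measurable_fun setT w by exact: measurable_funM.
have mv : measurable_fun setT v by exact: measurable_funD.
have v2 x : 0 <= v x <= 2 * K * m x.
  by have := uK x; rewrite ler_norml /v => /andP[? ?]; apply/andP; split; lra.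
have w1 x : 0 <= w x <= K * m x.
  by rewrite /w lexx andbT mulr_ge0//; case/andP: (m1 x).
have [iFv iGmv iGpv Ev] := SL_integral_ge0 mv v2.
have [iFw iGmw iGpw Ew] := SL_integral_ge0 mw w1.
have vK x : `|v x| <= 2 * K.
  have /andP[v0 vk] := v2 x; rewrite ger0_norm// (le_trans vk)// ler_piMr//.
    by rewrite mulr_ge0.
  by case/andP: (m1 x).
have wK x : `|w x| <= 2 * K.
  have /andP[w0 wk] := w1 x; rewrite ger0_norm// (le_trans wk)//.
  have /andP[_ m1x] := m1 x; apply: (@le_trans _ _ K); first by rewrite ler_piMr.
  by rewrite ler_peMl// ler1n.
have LB t : above mup t -> laplace (fun x : R => u (- x)) t =
    laplace (fun x : R => v (- x)) t - laplace (fun x : R => w (- x)) t.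
  move=> [t0 _]; rewrite vw (@laplaceB _ _ _ _ (2 * K))//; exact: measurable_funN_arg.
have LB' t : above (- mum) t -> laplace u t = laplace v t - laplace w t.
  by move=> [t0 _]; rewrite vw (@laplaceB _ _ _ _ (2 * K)).
have mA (b : R) := @measurable_above R b.
split.
- have := integrableB measurableT iFv iFw; apply: eq_integrable => // x _.
  by rewrite vw /= EFinB.
- have := integrableB (mA _) iGmv iGmw; apply: eq_integrable => // x /set_mem Ax.
  by rewrite /= LB// EFinB.
- have := integrableB (mA _) iGpv iGpw; apply: eq_integrable => // x /set_mem Ax.
  by rewrite /= LB'// EFinB.
- have -> : \int[F]_x u x = \int[F]_x v x - \int[F]_x w x.
    by rewrite vw; exact: (RintegralB measurableT iFv iFw).
  rewrite Ev Ew.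
  have -> : \int[Gm]_(t in above mup) laplace (fun x : R => u (- x)) t =
      \int[Gm]_(t in above mup) laplace (fun x : R => v (- x)) t -
      \int[Gm]_(t in above mup) laplace (fun x : R => w (- x)) t.
    rewrite -(RintegralB (mA _) iGmv iGmw).
    by apply: eq_Rintegral => t /set_mem /LB.
  have -> : \int[Gp]_(t in above (- mum)) laplace u t =
      \int[Gp]_(t in above (- mum)) laplace v t -
      \int[Gp]_(t in above (- mum)) laplace w t.
    rewrite -(RintegralB (mA _) iGpv iGpw).
    by apply: eq_Rintegral => t /set_mem /LB'.
  by rewrite opprD addrACA.
Qed.

End levy_integral.

(** * Complex-valued integrals *)

Lemma ReD (R : realType) (z w : R[i]) : complex.Re (z + w) = complex.Re z + complex.Re w.
Proof. by case: z w => [a b] [c e]. Qed.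

Lemma ImD (R : realType) (z w : R[i]) : complex.Im (z + w) = complex.Im z + complex.Im w.
Proof. by case: z w => [a b] [c e]. Qed.

Lemma ReM (R : realType) (z w : R[i]) :
  complex.Re (z * w) = complex.Re z * complex.Re w - complex.Im z * complex.Im w.
Proof. by case: z w => [a b] [c e]. Qed.

Lemma ImM (R : realType) (z w : R[i]) :
  complex.Im (z * w) = complex.Re z * complex.Im w + complex.Im z * complex.Re w.
Proof. by case: z w => [a b] [c e]. Qed.

Lemma complex_eta (R : realType) (z : R[i]) : z = complex.Re z +i* complex.Im z.
Proof. by case: z. Qed.

Section complex_measurable.
Variable R : realType.
Implicit Types f g : R -> R[i].

Definition cmeasurable f : Prop :=
  measurable_fun setT (fun t => complex.Re (f t)) /\
  measurable_fun setT (fun t => complex.Im (f t)).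

Lemma cmeasurable_cst (z : R[i]) : cmeasurable (fun=> z).
Proof. by split; exact: measurable_cst. Qed.

Lemma cmeasurable_real (u : R -> R) : measurable_fun setT u ->
  cmeasurable (fun t => (u t)%:C).
Proof. by move=> mu; split => //=; exact: measurable_cst. Qed.

Lemma cmeasurableD f g : cmeasurable f -> cmeasurable g ->
  cmeasurable (fun t => f t + g t).
Proof.
move=> [f1 f2] [g1 g2]; split.
- by under eq_fun do rewrite ReD; exact: measurable_funD.
- by under eq_fun do rewrite ImD; exact: measurable_funD.
Qed.

Lemma cmeasurableM f g : cmeasurable f -> cmeasurable g ->
  cmeasurable (fun t => f t * g t).
Proof.
move=> [f1 f2] [g1 g2]; split.
- by under eq_fun do rewrite ReM; apply: measurable_funB; exact: measurable_funM.
- by under eq_fun do rewrite ImM; apply: measurable_funD; exact: measurable_funM.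
Qed.

Lemma cmeasurableN f : cmeasurable f -> cmeasurable (fun t => - f t).
Proof.
move=> mf; have := cmeasurableM (cmeasurable_cst (-1)) mf.
by under eq_fun do rewrite mulN1r.
Qed.

Lemma cmeasurableB f g : cmeasurable f -> cmeasurable g ->
  cmeasurable (fun t => f t - g t).
Proof. by move=> mf mg; apply: cmeasurableD => //; exact: cmeasurableN. Qed.

Lemma cmeasurableX f n : cmeasurable f -> cmeasurable (fun t => f t ^+ n).
Proof.
move=> mf; elim: n => [|n ih].
  by under eq_fun do rewrite expr0; exact: cmeasurable_cst.
by under eq_fun do rewrite exprS; exact: cmeasurableM.
Qed.

Lemma cmeasurableV f : cmeasurable f -> cmeasurable (fun t => (f t)^-1).
Proof.
move=> [f1 f2].
have md : measurable_fun setT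
    (fun t => (complex.Re (f t) ^+ 2 + complex.Im (f t) ^+ 2)^-1).
  by apply: measurable_funV; apply: measurable_funD; exact: measurable_funX.
have -> : (fun t => (f t)^-1) = (fun t =>
    (complex.Re (f t) * (complex.Re (f t) ^+ 2 + complex.Im (f t) ^+ 2)^-1) +i*
    (- complex.Im (f t) * (complex.Re (f t) ^+ 2 + complex.Im (f t) ^+ 2)^-1)).
  by apply/funext => t; case: (f t) => a b; rewrite mulNr.
split => /=; apply: measurable_funM => //; exact: measurable_funN.
Qed.

End complex_measurable.

Section complex_integral.
Variables (R : realType) (G : {measure set R -> \bar R}) (D : set R).
Hypothesis mD : measurable D.
Implicit Types f g : R -> R[i].

Definition cint f : R[i] :=
  (\int[G]_(t in D) complex.Re (f t)) +i* (\int[G]_(t in D) complex.Im (f t)).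

Definition cintegrable f : Prop :=
  G.-integrable D (fun t => (complex.Re (f t))%:E) /\
  G.-integrable D (fun t => (complex.Im (f t))%:E).

Lemma eq_cint f g : (forall t, D t -> f t = g t) -> cint f = cint g.
Proof.
by move=> fg; rewrite /cint; congr (_ +i* _); apply: eq_Rintegral => t /set_mem /fg ->.
Qed.

Lemma cintegrableD f g : cintegrable f -> cintegrable g ->
  cintegrable (fun t => f t + g t).
Proof.
move=> [f1 f2] [g1 g2]; split.
- by have := integrableD mD f1 g1; apply: eq_integrable => // t _; rewrite ReD EFinD.
- by have := integrableD mD f2 g2; apply: eq_integrable => // t _; rewrite ImD EFinD.
Qed.

Lemma cintD f g : cintegrable f -> cintegrable g ->
  cint (fun t => f t + g t) = cint f + cint g.
Proof.
move=> [f1 f2] [g1 g2]; rewrite /cint.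
have -> (a b c e : R) : (a +i* b) + (c +i* e) = (a + c) +i* (b + e) by [].
rewrite -(RintegralD mD f1 g1) -(RintegralD mD f2 g2).
by congr (_ +i* _); apply: eq_Rintegral => t _; rewrite ?ReD ?ImD.
Qed.

Let integrable_real_comb (a b : R) (u v : R -> R) :
  G.-integrable D (EFin \o u) -> G.-integrable D (EFin \o v) ->
  G.-integrable D (fun t => (a * u t + b * v t)%:E) /\
  \int[G]_(t in D) (a * u t + b * v t) =
  a * \int[G]_(t in D) u t + b * \int[G]_(t in D) v t.
Proof.
move=> iu iv.
have iau : G.-integrable D (EFin \o (fun t => a * u t)).
  by have := integrableZl mD a iu; apply: eq_integrable => // t _; rewrite /= EFinM.
have ibv : G.-integrable D (EFin \o (fun t => b * v t)).
  by have := integrableZl mD b iv; apply: eq_integrable => // t _; rewrite /= EFinM.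
split.
  by have := integrableD mD iau ibv; apply: eq_integrable => // t _; rewrite /= EFinD.
by rewrite (RintegralD mD iau ibv) (RintegralZl _ mD iu) (RintegralZl _ mD iv).
Qed.

Lemma cintegrableZ (c : R[i]) f : cintegrable f -> cintegrable (fun t => c * f t).
Proof.
move=> [f1 f2]; split.
- have [+ _] := integrable_real_comb (complex.Re c) (- complex.Im c) f1 f2.
  by apply: eq_integrable => // t _; rewrite ReM mulNr.
- have [+ _] := integrable_real_comb (complex.Re c) (complex.Im c) f2 f1.
  by apply: eq_integrable => // t _; rewrite ImM.
Qed.

Lemma cintZ (c : R[i]) f : cintegrable f -> cint (fun t => c * f t) = c * cint f.
Proof.
move=> [f1 f2]; rewrite /cint [RHS]complex_eta ReM ImM /=.
have [_ E1] := integrable_real_comb (complex.Re c) (- complex.Im c) f1 f2.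
have [_ E2] := integrable_real_comb (complex.Re c) (complex.Im c) f2 f1.
congr (_ +i* _).
- by rewrite -mulNr -E1; apply: eq_Rintegral => t _; rewrite ReM mulNr.
- by rewrite -E2; apply: eq_Rintegral => t _; rewrite ImM.
Qed.

Lemma cintegrable_sum n (F : nat -> R -> R[i]) : (forall k, cintegrable (F k)) ->
  cintegrable (fun t => \sum_(0 <= k < n) F k t) /\
  cint (fun t => \sum_(0 <= k < n) F k t) = \sum_(0 <= k < n) cint (F k).
Proof.
move=> iF; elim: n => [|n [ih1 ih2]].
  split; last first.
    rewrite big_nil /cint; under eq_Rintegral do rewrite big_nil.
    under [X in _ +i* X]eq_Rintegral do rewrite big_nil.
    by rewrite /Rintegral !integral0.
  by split; under eq_fun do rewrite big_nil; exact: integrable0.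
have E t : \sum_(0 <= k < n.+1) F k t = \sum_(0 <= k < n) F k t + F n t.
  by rewrite big_nat_recr.
split.
  have [i1 i2] := cintegrableD ih1 (iF n).
  by split; [apply: eq_integrable i1|apply: eq_integrable i2] => // t _; rewrite E.
by rewrite big_nat_recr//= -ih2 -cintD//; apply: eq_cint => t _.
Qed.

(** The factor 2 comes from estimating real and imaginary parts separately; any constant serves for
    remainder bounds. *)
Lemma cintegrable_le f (w : R -> R) (C : R) : cmeasurable f ->
  G.-integrable D (EFin \o w) -> (forall t, D t -> normc (f t) <= C * w t) ->
  cintegrable f /\ normc (cint f) <= 2 * (C * \int[G]_(t in D) w t).
Proof.
move=> [f1 f2] iw fw.
have iCw : G.-integrable D (EFin \o (fun t => C * w t)).
  by have := integrableZl mD C iw; apply: eq_integrable => // t _; rewrite /= EFinM.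
have bnd (u : R -> R) : measurable_fun setT u -> (forall t, D t -> `|u t| <= C * w t) ->
    G.-integrable D (EFin \o u) /\ `|\int[G]_(t in D) u t| <= C * \int[G]_(t in D) w t.
  move=> mu uw.
  have iu : G.-integrable D (EFin \o u).
    apply: le_integrable iCw => //.
      by apply/measurable_EFinP; exact: measurable_funTS.
    move=> t Dt /=; rewrite lee_fin; apply: le_trans (uw t Dt) _.
    exact: ler_norm.
  split => //; apply: le_trans (le_normr_Rintegral mD iu) _.
  rewrite -(RintegralZl _ mD iw); apply: le_Rintegral => //.
  by have := integrable_abse iu; apply: eq_integrable.
have [i1 b1] := bnd _ f1 (fun t Dt => le_trans (normc_ge_absRe _) (fw t Dt)).
have [i2 b2] := bnd _ f2 (fun t Dt => le_trans (normc_ge_absIm _) (fw t Dt)).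
split => //; apply: le_trans (normc_le_ReIm _) _.
by rewrite mulrDl mul1r lerD.
Qed.

End complex_integral.

(** * The compensated Stieltjes kernel *)

Section stieltjes_kernel.
Variable R : realType.
Implicit Types (t m : R) (z h : R[i]).

(** The Laplace transform of 1 - cos x. It has the same order as the compensated kernel: 1/t at 0
    and 1/t^3 at infinity. *)
Definition stieltjes_weight t : R := (t * (1 + t ^+ 2))^-1.

(* The term [z / (1 + t^2)] makes the kernel integrable at infinity; it differs
   from the truncation of [levy_khintchine] by a drift. *)
Definition stieltjes_kernel t z : R[i] :=
  (t%:C - z)^-1 - (t^-1)%:C - z * ((1 + t ^+ 2)^-1)%:C.

Definition off_cut m z : Prop := complex.Im z <> 0 \/ complex.Re z < m.

(** A lower bound linear in 1 + t combines the positive distance to the cut with the growth in t,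
    and makes all resolvent powers comparable with the weight. *)
Lemma off_cut_dist m z : off_cut m z -> exists2 d : R, 0 < d &
  forall t, above m t -> d * (1 + t) <= normc (t%:C - z).
Proof.
move=> mz; pose x := complex.Re z.
have [y y0 Hy] : exists2 y : R, 0 < y & forall t, above m t -> y <= normc (t%:C - z).
  case: mz => [/eqP z0|zm].
  - exists `|complex.Im z|; first by rewrite normr_gt0.
    move=> t _; apply: le_trans (normc_ge_absIm _).
    by case: z {x z0} => a b /=; rewrite sub0r normrN.
  - exists (m - x); first by rewrite subr_gt0.
    move=> t [_ mt]; apply: le_trans (normc_ge_absRe _).
    apply: le_trans (ler_norm _); rewrite /x; case: z {zm x} => a b /=; lra.
have d0 : 0 < 1 + (1 + `|x|) / y.
  by rewrite ltr_pwDl// divr_ge0 ?addr_ge0// ltW.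
(* From 1 + t = (t - |x|) + (1 + |x|), where both summands are bounded by multiples of |t - z|: the
   first directly, the second through the minimal distance [y]. *)
exists (1 + (1 + `|x|) / y)^-1; first by rewrite invr_gt0.
move=> t mt; have t0 := above_gt0 mt.
rewrite mulrC ler_pdivrMr// mulrDr mulr1.
have tx : t - `|x| <= normc (t%:C - z).
  apply: le_trans (normc_ge_absRe _); apply: le_trans (ler_norm _).
  by have := ler_norm x; rewrite /x; case: (z) => a b /=; lra.
have : 1 + `|x| <= normc (t%:C - z) * ((1 + `|x|) / y).
  rewrite mulrCA ler_peMr ?addr_ge0//.
  by rewrite ler_pdivlMr// mul1r Hy.
by lra.
Qed.

Lemma stieltjes_weight_ge t : 0 < t -> ((1 + t) ^+ 3)^-1 <= stieltjes_weight t.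
Proof.
move=> t0; rewrite /stieltjes_weight lef_pV2 ?posrE.
- by rewrite -subr_ge0 (_ : _ - _ = 1 + 2 * t + 3 * t ^+ 2); [nra|ring].
- by rewrite exprn_gt0//; lra.
- by rewrite mulr_gt0// ltr_pwDl ?sqr_ge0.
Qed.

Lemma subC_neq0 m z t : off_cut m z -> above m t -> t%:C - z != 0.
Proof.
move=> /off_cut_dist[d d0 Hd] mt; rewrite -normc_gt0.
by apply: lt_le_trans (Hd t mt); rewrite mulr_gt0//; have := above_gt0 mt; lra.
Qed.

Lemma one_plus_sqr_neq0 t : (1 + t ^+ 2)%:C != 0 :> R[i].
Proof.
by rewrite eq_complex /= eqxx andbT gt_eqF// ltr_pwDl ?sqr_ge0.
Qed.

Lemma realC_inv t : (t^-1)%:C = (t%:C)^-1 :> R[i].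
Proof. exact: fmorphV. Qed.

Lemma realC_neq0 t : 0 < t -> t%:C != 0 :> R[i].
Proof. by move=> t0; rewrite eq_complex /= eqxx andbT gt_eqF. Qed.

(** The factored form shows the cancellation at infinity: (1 + t z)/(t - z) is bounded in t. *)
Lemma stieltjes_kernelE m z t : off_cut m z -> above m t ->
  stieltjes_kernel t z =
  z * (1 + t%:C * z) / (t%:C - z) * (stieltjes_weight t)%:C.
Proof.
move=> mz mt; have t0 := above_gt0 mt.
have v0 := subC_neq0 mz mt; have q0 := one_plus_sqr_neq0 t; have tC0 := realC_neq0 t0.
rewrite /stieltjes_kernel /stieltjes_weight !realC_inv !(rmorphM, rmorphD, rmorph1, rmorphXn)/=.
rewrite !(rmorphM, rmorphD, rmorph1, rmorphXn)/= in q0.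
by field; rewrite ?q0 ?v0 ?tC0.
Qed.

(** Taylor coefficients of [stieltjes_kernel t] at z: those of the resolvent, the first two being
    altered by the compensating terms. *)
Definition kernel_coef z (k : nat) t : R[i] :=
  match k with
  | 0 => stieltjes_kernel t z
  | 1 => (t%:C - z) ^- 2 - ((1 + t ^+ 2)^-1)%:C
  | _ => (t%:C - z) ^- k.+1
  end.

(** The remainder of a geometric series. From order 2 on, the terms added to the resolvent, affine
    in z, have cancelled. *)
Lemma kernel_remainder z h t n : t%:C - z != 0 -> t%:C - (z + h) != 0 ->
  stieltjes_kernel t (z + h) - \sum_(0 <= k < n.+2) kernel_coef z k t * h ^+ k =
  h ^+ n.+2 * (t%:C - z) ^- n.+2 * (t%:C - (z + h))^-1.
Proof.
have -> : t%:C - (z + h) = t%:C - z - h by ring.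
move=> v0 w0; elim: n => [|n ih].
  rewrite !big_nat_recr//= big_nil /stieltjes_kernel.
  rewrite (_ : t%:C - (z + h) = t%:C - z - h); last by ring.
  set v := t%:C - z in v0 w0 *.
  move: ((t^-1)%:C) (((1 + t ^+ 2)^-1)%:C) => T c; by field; rewrite v0 w0.
rewrite big_nat_recr//= opprD addrA ih.
set v := t%:C - z in v0 w0 *.
rewrite [v ^+ n.+3]exprS [h ^+ n.+3]exprS.
have vn : v ^+ n.+2 != 0 by rewrite expf_neq0.
by field; rewrite v0 w0 vn.
Qed.

Lemma cmeasurable_resolvent z n : cmeasurable (fun t => (t%:C - z) ^- n).
Proof.
apply: cmeasurableV; apply: cmeasurableX; apply: cmeasurableB.
  exact: cmeasurable_real.
exact: cmeasurable_cst.
Qed.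

Lemma cmeasurable_inv_sqr : cmeasurable (fun t => ((1 + t ^+ 2)^-1)%:C).
Proof.
apply: cmeasurable_real; apply: measurable_funV.
by apply: measurable_funD => //; exact: exprn_measurable.
Qed.

Lemma cmeasurable_kernel_coef z k : cmeasurable (kernel_coef z k).
Proof.
case: k => [|[|k]] /=; last exact: cmeasurable_resolvent.
- apply: cmeasurableB; first apply: cmeasurableB.
  + by have := cmeasurable_resolvent z 1; under eq_fun do rewrite expr1.
  + by apply: cmeasurable_real; exact: measurable_funV.
  + by apply: cmeasurableM; [exact: cmeasurable_cst|exact: cmeasurable_inv_sqr].
- by apply: cmeasurableB; [exact: cmeasurable_resolvent|exact: cmeasurable_inv_sqr].
Qed.

Lemma normc_resolvent z t d k : 0 < d -> 0 < t -> d * (1 + t) <= normc (t%:C - z) ->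
  normc ((t%:C - z) ^- k) <= (d * (1 + t)) ^- k.
Proof.
move=> d0 t0 dt; have p0 : 0 < d * (1 + t) by rewrite mulr_gt0//; lra.
rewrite normcV normcX lef_pV2 ?posrE ?exprn_gt0 ?(lt_le_trans p0)//.
by rewrite lerXn2r ?nnegrE ?normc_ge0 ?(ltW p0).
Qed.

Lemma kernel_coef_bound m z k : off_cut m z -> exists C : R,
  forall t, above m t -> normc (kernel_coef z k t) <= C * stieltjes_weight t.
Proof.
move=> mz; have [d d0 Hd] := off_cut_dist mz.
pose a := normc z; have a0 : 0 <= a := normc_ge0 z.
case: k => [|[|k]].
- exists (a * (1 + a) / d) => t mt; have t0 := above_gt0 mt.
  have w0 : 0 < stieltjes_weight t.
    by rewrite invr_gt0 mulr_gt0// ltr_pwDl ?sqr_ge0.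
  rewrite /= (stieltjes_kernelE mz mt) normcM normc_real (gtr0_norm w0) ler_wpM2r ?(ltW w0)//.
  rewrite !normcM -/a -!mulrA ler_wpM2l//.
  have H1 : normc (1 + t%:C * z) <= (1 + a) * (1 + t).
    apply: le_trans (ler_normcD _ _) _.
    rewrite normcM normc_real (gtr0_norm t0) -/a -[1]/(1%:C) normc_real normr1; nra.
  have H2 := normc_resolvent 1 d0 t0 (Hd t mt).
  rewrite !expr1 in H2.
  apply: le_trans (ler_pM _ _ H1 H2) _; rewrite ?normc_ge0//.
  by rewrite le_eqVlt; apply/orP; left; apply/eqP; field; lra.
(* Each of the two terms decays only like 1/t^2; over a common denominator the t^2 cancel and the
   numerator 1 + 2tz - z^2 is linear in t. *)
- exists ((1 + a) ^+ 2 / d ^+ 2) => t mt; have t0 := above_gt0 mt.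
  have v0 := subC_neq0 mz mt; have q0 := one_plus_sqr_neq0 t.
  have -> : kernel_coef z 1 t =
     (1 + 2 * t%:C * z - z ^+ 2) * (t%:C - z) ^- 2 * ((1 + t ^+ 2)^-1)%:C.
    rewrite /= !realC_inv !(rmorphD, rmorph1, rmorphXn)/= in q0 *.
    by field; rewrite q0 v0.
  have H1 : normc (1 + 2 * t%:C * z - z ^+ 2) <= (1 + a) ^+ 2 * (1 + t).
    apply: le_trans (ler_normcB _ _) _; rewrite normcX -/a.
    apply: (@le_trans _ _ (1 + 2 * t * a + a ^+ 2)); last by nra.
    rewrite lerD2r; apply: le_trans (ler_normcD _ _) _.
    rewrite (_ : 2 * t%:C * z = (2 * t)%:C * z); last by rewrite rmorphM rmorph_nat.
    rewrite -[1]/(1%:C) normc_real normr1.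
    by rewrite normcM normc_real ger0_norm -/a//; nra.
  have H2 := normc_resolvent 2 d0 t0 (Hd t mt).
  have c0 : 0 < (1 + t ^+ 2)^-1 by rewrite invr_gt0 ltr_pwDl ?sqr_ge0.
  rewrite 2!normcM normc_real (gtr0_norm c0).
  apply: (@le_trans _ _ ((1 + a) ^+ 2 * (1 + t) * (d * (1 + t)) ^- 2 * (1 + t ^+ 2)^-1)).
    by rewrite ler_wpM2r ?(ltW c0)// ler_pM ?normc_ge0.
  have -> : (1 + a) ^+ 2 * (1 + t) * (d * (1 + t)) ^- 2 * (1 + t ^+ 2)^-1 =
     (1 + a) ^+ 2 / d ^+ 2 * ((1 + t) * (1 + t ^+ 2))^-1.
    have q1 : 1 + t ^+ 2 != 0 by rewrite gt_eqF// ltr_pwDl ?sqr_ge0.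
    have p1 : 1 + t != 0 by rewrite gt_eqF//; lra.
    by field; rewrite q1 p1 gt_eqF.
  rewrite ler_wpM2l ?divr_ge0 ?sqr_ge0// lef_pV2 ?posrE.
  + by rewrite ler_wpM2r ?addr_ge0 ?sqr_ge0//; lra.
  + by rewrite mulr_gt0 ?ltr_pwDl ?sqr_ge0//; lra.
  + by rewrite mulr_gt0 ?ltr_pwDl ?sqr_ge0//; lra.
- exists (d ^- k.+3) => t mt; have t0 := above_gt0 mt.
  apply: le_trans (normc_resolvent _ d0 t0 (Hd t mt)) _.
  rewrite exprMn invfM ler_wpM2l ?invr_ge0 ?exprn_ge0 ?(ltW d0)//.
  apply: le_trans (stieltjes_weight_ge t0).
  rewrite lef_pV2 ?posrE ?exprn_gt0//; try lra.
  by rewrite ler_eXn2l//; lra.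
Qed.

End stieltjes_kernel.

Section stieltjes_transform.
Variables (R : realType) (G : {measure set R -> \bar R}) (m : R).
Hypothesis iW : G.-integrable (above m) (EFin \o @stieltjes_weight R).
Implicit Types (t : R) (z h : R[i]).

Definition stieltjes z : R[i] := cint G (above m) (fun t => stieltjes_kernel t z).

Let mA : measurable (above m). Proof. exact: measurable_above. Qed.

Lemma cintegrable_kernel_coef z k : off_cut m z ->
  cintegrable G (above m) (kernel_coef z k).
Proof.
move=> /kernel_coef_bound - /(_ k)[C HC].
by have [] := cintegrable_le mA (cmeasurable_kernel_coef z k) iW HC.
Qed.

Lemma stieltjes_power_series z : off_cut m z -> has_power_series stieltjes z.
Proof.
move=> mz; have [d d0 Hd] := off_cut_dist mz.
pose IW := \int[G]_(t in above m) stieltjes_weight t.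
have IW0 : 0 <= IW.
  apply: Rintegral_ge0 => t [t0 _].
  by rewrite /stieltjes_weight invr_ge0 mulr_ge0 ?addr_ge0 ?sqr_ge0// ltW.
have r0 : 0 < d / 2 by lra.
(* The Taylor expansion is integrated term by term. With |h| < d/2 the bound of [off_cut_dist]
   persists at z + h with half the constant, uniformly in t. In 4/d, one factor 2 comes from
   [cintegrable_le] and 2/d from the last resolvent. *)
apply: (@power_series_of_ge2 _ _ _ (fun k => cint G (above m) (kernel_coef z k))
  (d / 2) (4 / d * IW)) => // h hr [|[|n]]// _.
have mid t : above m t -> (d * (1 + t)) / 2 <= normc (t%:C - (z + h)).
  move=> mt; have t0 := above_gt0 mt.
  have := Hd t mt.
  have -> : t%:C - z = (t%:C - (z + h)) + h by ring.
  have := ler_normcD (t%:C - (z + h)) h.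
  have : d <= d * (1 + t) by rewrite ler_peMr; lra.
  by lra.
have w0 t : above m t -> t%:C - (z + h) != 0.
  move=> mt; rewrite -normc_gt0; apply: lt_le_trans (mid t mt).
  by rewrite divr_gt0// mulr_gt0//; have := above_gt0 mt; lra.
have ick k := cintegrable_kernel_coef k mz.
have icsum := cintegrable_sum mA n.+2
  (fun k => cintegrableZ mA (h ^+ k) (ick k)).
have zE : forall t, above m t -> stieltjes_kernel t (z + h) =
    (stieltjes_kernel t (z + h) - \sum_(0 <= k < n.+2) h ^+ k * kernel_coef z k t) +
    \sum_(0 <= k < n.+2) h ^+ k * kernel_coef z k t.
  by move=> t _; rewrite subrK.
pose rem t : R[i] := h ^+ n.+2 * (t%:C - z) ^- n.+2 * (t%:C - (z + h)) ^- 1.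
have remE t : above m t -> stieltjes_kernel t (z + h) -
    \sum_(0 <= k < n.+2) h ^+ k * kernel_coef z k t = rem t.
  move=> mt; under eq_bigr do rewrite mulrC.
  by rewrite kernel_remainder ?w0 ?(subC_neq0 mz mt)// /rem expr1.
have mrem : cmeasurable rem.
  apply: cmeasurableM; last exact: cmeasurable_resolvent.
  by apply: cmeasurableM; [exact: cmeasurable_cst|exact: cmeasurable_resolvent].
have bnd t : above m t -> normc (rem t) <=
    (2 / d * (normc h / (d / 2)) ^+ n.+2) * stieltjes_weight t.
  move=> mt; have t0 := above_gt0 mt.
  have p0 : 0 < d * (1 + t) by rewrite mulr_gt0//; lra.
  have h0 := normc_ge0 h.
  have q0 : 0 < d / 2 * (1 + t) by rewrite mulr_gt0//; lra.
  have mid' : d / 2 * (1 + t) <= normc (t%:C - (z + h)) by have := mid t mt; lra.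
  rewrite 2!normcM normcX.
  have H1 := normc_resolvent n.+2 d0 t0 (Hd t mt).
  have H2 := normc_resolvent 1 r0 t0 mid'.
  apply: (@le_trans _ _ (normc h ^+ n.+2 * (d * (1 + t)) ^- n.+2 * (d / 2 * (1 + t)) ^- 1)).
    apply: ler_pM; [|exact: normc_ge0| |exact: H2].
      exact: mulr_ge0 (exprn_ge0 _ h0) (normc_ge0 _).
    exact: ler_wpM2l (exprn_ge0 _ h0) _ _ H1.
  have -> : normc h ^+ n.+2 * (d * (1 + t)) ^- n.+2 * (d / 2 * (1 + t)) ^- 1 =
      2 / d * (normc h / d) ^+ n.+2 * ((1 + t) ^- n.+3).
    rewrite expr1 exprMn expr_div_n [(1 + t) ^+ n.+3]exprS.
    have dn : d ^+ n.+2 != 0 by rewrite expf_neq0// gt_eqF.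
    have p1 : 1 + t != 0 by rewrite gt_eqF//; lra.
    have pn : (1 + t) ^+ n.+2 != 0 by rewrite expf_neq0.
    by field; rewrite p1 pn dn gt_eqF.
  rewrite -[leLHS]mulrA -[leRHS]mulrA; apply: ler_wpM2l.
    by rewrite divr_ge0// ltW.
  apply: ler_pM.
  - by rewrite exprn_ge0// divr_ge0// ltW.
  - by rewrite invr_ge0 exprn_ge0//; lra.
  - rewrite lerXn2r ?nnegrE ?divr_ge0//; try lra.
    by rewrite ler_wpM2l// lef_pV2 ?posrE; lra.
  - apply: le_trans (stieltjes_weight_ge t0).
    rewrite lef_pV2 ?posrE ?exprn_gt0//; try lra.
    by rewrite ler_weXn2l//; lra.
have [irem Brem] := cintegrable_le mA mrem iW bnd.
have -> : stieltjes (z + h) = cint G (above m) rem +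
    cint G (above m) (fun t => \sum_(0 <= k < n.+2) h ^+ k * kernel_coef z k t).
  rewrite -(cintD mA irem icsum.1); apply: eq_cint => t mt.
  by rewrite -remE// subrK.
rewrite icsum.2 (eq_bigr (fun k => cint G (above m) (kernel_coef z k) * h ^+ k)); last first.
  by move=> k _; rewrite (cintZ mA _ (ick k)) mulrC.
rewrite addrK; apply: le_trans Brem _.
rewrite -/IW le_eqVlt; apply/orP; left; apply/eqP.
by rewrite -!mulrA [IW * _]mulrC !mulrA; congr (_ * _ * _); ring.
Qed.

(** The kernel divided by z is 1/(t (t - z)) - 1/(1 + t^2), whose imaginary part has the sign of Im
    z; multiplying by the conjugate instead of dividing only adds the factor |z|^2. *)
Lemma stieltjes_Im_conj z : complex.Im z <> 0 ->
  0 <= complex.Im z * complex.Im (stieltjes z * z^*).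
Proof.
move=> z0; have mz : off_cut m z by left.
have ik := cintegrable_kernel_coef 0 mz.
rewrite mulrC [stieltjes z * _]mulrC -(cintZ mA _ ik) /cint /=.
have [_ i2] := cintegrableZ mA z^* ik.
rewrite -(RintegralZr _ mA i2); apply: Rintegral_ge0 => t mt.
have t0 := above_gt0 mt.
have v0 := subC_neq0 mz mt.
have -> : z^* * stieltjes_kernel t z = (z^* * z) *
    ((t^-1)%:C * (t%:C - z)^-1 - ((1 + t ^+ 2)^-1)%:C).
  rewrite /stieltjes_kernel -mulrA; congr (_ * _).
  rewrite realC_inv; have := realC_neq0 t0; move: (((1 + t ^+ 2)^-1)%:C) => c tC0.
  by field; rewrite v0 tC0.
have -> : z^* * z = (complex.Re z ^+ 2 + complex.Im z ^+ 2)%:C.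
  by rewrite mulrC -sqr_normc add_Re2_Im2.
have -> : complex.Im ((complex.Re z ^+ 2 + complex.Im z ^+ 2)%:C *
    ((t^-1)%:C * (t%:C - z)^-1 - ((1 + t ^+ 2)^-1)%:C)) =
    (complex.Re z ^+ 2 + complex.Im z ^+ 2) * (t^-1 * complex.Im (t%:C - z)^-1).
  by rewrite ImM ImD ImM /= oppr0 !mul0r !addr0.
have -> : complex.Im (t%:C - z)^-1 =
    complex.Im z / ((t - complex.Re z) ^+ 2 + complex.Im z ^+ 2).
  by case: (z) => x y /=; rewrite sub0r sqrrN -mulNr opprK.
rewrite -!mulrA mulr_ge0 ?addr_ge0 ?sqr_ge0// mulr_ge0 ?invr_ge0 ?(ltW t0)//.
rewrite mulrC -mulrA mulr_ge0 ?invr_ge0 ?addr_ge0 ?sqr_ge0//.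
Qed.

Lemma stieltjes_real (x : R) : x < m -> complex.Im (stieltjes x%:C) = 0.
Proof.
move=> xm; transitivity (\int[G]_(t in above m) (0 : R)).
  apply: eq_Rintegral => t _.
  by rewrite /stieltjes_kernel -!rmorphB -rmorphM -fmorphV -!rmorphB.
by rewrite /Rintegral integral0.
Qed.

Lemma stieltjes_kernel_real (t x : R) :
  complex.Re (stieltjes_kernel t x%:C) = (t - x)^-1 - t^-1 - x / (1 + t ^+ 2).
Proof. by rewrite /stieltjes_kernel -!rmorphB -rmorphM -fmorphV -!rmorphB. Qed.

Lemma stieltjes_div_nondecreasing (x y : R) : x != 0 -> y != 0 -> x <= y -> y < m ->
  complex.Re (stieltjes x%:C) / x <= complex.Re (stieltjes y%:C) / y.
Proof.
move=> x0 y0 xy ym; have xm := le_lt_trans xy ym.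
have ix : off_cut m x%:C by right.
have iy : off_cut m y%:C by right.
have [jx _] := cintegrable_kernel_coef 0 ix.
have [jy _] := cintegrable_kernel_coef 0 iy.
rewrite /stieltjes /cint /= -(RintegralZr _ mA jx) -(RintegralZr _ mA jy).
apply: le_Rintegral => //.
- by have := integrableZr mA x^-1 jx; apply: eq_integrable => // t _; rewrite -EFinM.
- by have := integrableZr mA y^-1 jy; apply: eq_integrable => // t _; rewrite -EFinM.
move=> t [t0 mt]; rewrite !stieltjes_kernel_real.
have H u : u != 0 -> u < m -> ((t - u)^-1 - t^-1 - u / (1 + t ^+ 2)) / u =
    (t * (t - u))^-1 - (1 + t ^+ 2)^-1.
  move=> u0 um; have q1 : 1 + t ^+ 2 != 0 by rewrite gt_eqF// ltr_pwDl ?sqr_ge0.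
  have tu : t - u != 0 by rewrite gt_eqF//; lra.
  have tn : t != 0 by rewrite gt_eqF.
  by field; rewrite u0 q1 tu tn.
rewrite !H// lerD2r lef_pV2 ?posrE ?mulr_gt0//; try lra.
by rewrite ler_wpM2l//; lra.
Qed.

End stieltjes_transform.

(** * The Levy-Khintchine exponent as a Stieltjes integral *)

Section trigonometric_bounds.
Variable R : realType.
Implicit Types x y : R.

Lemma MVT_abs (f df : R -> R) x : (forall y, is_derive y 1 f (df y)) ->
  exists2 c, `|c| <= `|x| & f x - f 0 = df c * x.
Proof.
move=> dff; have cf (a b : R) : {within `[a, b], continuous f}.
  apply: continuous_subspaceT => y; apply: differentiable_continuous.
  by apply/derivable1_diffP; exact: ex_derive.
have [x0|x0] := leP 0 x.
- have [c] := @MVT_segment R f df 0 x x0 (fun y _ => dff y) (cf 0 x).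
  rewrite in_itv/= subr0 => /andP[c0 cx] ->; exists c => //.
  by rewrite !ger0_norm.
- have [c] := @MVT_segment R f df x 0 (ltW x0) (fun y _ => dff y) (cf x 0).
  rewrite in_itv/= sub0r => /andP[xc c0] E; exists c.
    by rewrite !ler0_norm ?(ltW x0)// lerN2.
  by rewrite -[LHS]opprB E; ring.
Qed.

Lemma norm_sin_le x : `|sin x| <= `|x|.
Proof.
have [c _] := @MVT_abs (@sin R) (@cos R) x (fun y => is_derive_sin y).
rewrite sin0 subr0 => ->; rewrite normrM ler_piMl//.
by rewrite ler_norml cos_geN1 cos_le1.
Qed.

Lemma onem_cosE x : 1 - cos x = 2 * sin (x / 2) ^+ 2.
Proof.
have -> : cos x = cos (x / 2 + x / 2) by congr cos; lra.
rewrite cosD -!expr2; have := cos2Dsin2 (x / 2); lra.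
Qed.

Lemma onem_cos_le x : 0 <= 1 - cos x <= x ^+ 2 / 2.
Proof.
rewrite subr_ge0 cos_le1/= onem_cosE.
have := norm_sin_le (x / 2); rewrite -ler_sqr ?nnegrE// !real_normK ?num_real//.
by rewrite expr_div_n; lra.
Qed.

Lemma onem_cos_le_norm x : 1 - cos x <= `|x|.
Proof.
rewrite onem_cosE -real_normK ?num_real//.
have := norm_sin_le (x / 2); rewrite normrM (gtr0_norm (_ : 0 < 2^-1))//.
have := norm_sin_le1 (x / 2); have := normr_ge0 (sin (x / 2)); nra.
Qed.

Lemma norm_subr_sin_le x : `|x - sin x| <= x ^+ 2.
Proof.
have df (y : R) : is_derive y 1 (fun y => y - sin y) (1 - cos y).
  exact: is_deriveB (is_derive_id y 1) (is_derive_sin y).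
have [c cx] := @MVT_abs _ _ x df.
rewrite sin0 !subr0 => ->; have /andP[c0 _] := onem_cos_le c.
rewrite normrM -[x ^+ 2]real_normK ?num_real// expr2 ler_wpM2r//.
by rewrite ger0_norm// (le_trans (onem_cos_le_norm c)).
Qed.

(** The 2 serves |x| >= 1 and xi^2 serves small x; the same constant works for the sine part
    below. *)
Lemma onem_cos_bound xi x :
  `|1 - cos (xi * x)| <= (2 + xi ^+ 2) * Num.min 1 (x ^+ 2).
Proof.
have /andP[c0 c1] := onem_cos_le (xi * x); rewrite ger0_norm//.
rewrite exprMn in c1; have xi2 := sqr_ge0 xi; have x2 := sqr_ge0 x.
have [x1|x1] := leP 1 (x ^+ 2).
- by rewrite mulr1; have := cos_geN1 (xi * x); lra.
- have : 0 <= xi ^+ 2 * x ^+ 2 by rewrite mulr_ge0.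
  by rewrite mulrDl; lra.
Qed.

Lemma truncated_sin_bound xi x :
  `|xi * x * \1_(`[-1, 1]%classic : set R) x - sin (xi * x)| <=
  (2 + xi ^+ 2) * Num.min 1 (x ^+ 2).
Proof.
have xi2 := sqr_ge0 xi; have x2 := sqr_ge0 x.
rewrite indicE; have [/set_mem|] := boolP (x \in _).
- rewrite /= in_itv/= => /andP[x1 x1'].
  have xle1 : x ^+ 2 <= 1.
    by rewrite -subr_ge0 (_ : 1 - x ^+ 2 = (1 - x) * (1 + x)); [rewrite mulr_ge0; lra|ring].
  rewrite mulr1 (min_idPr xle1).
  apply: le_trans (norm_subr_sin_le _) _; rewrite exprMn; nra.
- rewrite notin_setE /= in_itv/= => xn.
  have x1 : 1 <= x ^+ 2.
    rewrite leNgt; apply/negP => x21; apply: xn.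
    have xa : `|x| < 1 by rewrite -(ltr_pXn2r (ltn0Sn 1)) ?nnegrE// expr1n real_normK ?num_real.
    by move: xa; rewrite ltr_norml => /andP[? ?]; apply/andP; split; lra.
  rewrite mulr0 sub0r normrN (min_idPl x1) mulr1.
  by apply: le_trans (norm_sin_le1 _) _; lra.
Qed.

End trigonometric_bounds.

(** * From the Lévy-Khintchine formula to the cumulant *)

Section levy_khintchine.
Variables (R : realType) (mum mup : R) (F Gm Gp : {measure set R -> \bar R}).
Hypotheses (SLM_Gm : SLM mup Gm) (SLM_Gp : SLM (- mum) Gp).
Hypothesis FE : forall A : set R, measurable A ->
  F A = (\int[lebesgue_measure]_(x in A) SL_density Gm Gp x)%E.
Hypothesis levyF : is_levy_measure F.
Implicit Types xi t : R.

(** [u1] and [u2] are the real and imaginary parts of the integrand of [levy_khintchine]. *)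
Let u1 xi (x : R) : R := 1 - cos (xi * x).
Let u2 xi (x : R) : R := xi * x * \1_(`[-1, 1]%classic : set R) x - sin (xi * x).

Let mu1 xi : measurable_fun setT (u1 xi).
Proof. by apply: measurable_funB => //; exact: measurable_cos_mul. Qed.

Let mtrunc xi : measurable_fun setT (fun x : R => xi * x * \1_(`[-1, 1]%classic : set R) x).
Proof.
by apply: measurable_funM; [exact: measurable_funM|exact: measurable_indic].
Qed.

Let mu2 xi : measurable_fun setT (u2 xi).
Proof. by apply: measurable_funB => //; exact: measurable_sin_mul. Qed.

Let SLu1 xi := SL_integral SLM_Gm SLM_Gp FE levyF (mu1 xi) (onem_cos_bound xi).
Let SLu2 xi := SL_integral SLM_Gm SLM_Gp FE levyF (mu2 xi) (truncated_sin_bound xi).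

Let u1N xi : (fun x : R => u1 xi (- x)) = u1 xi.
Proof. by apply/funext => x; rewrite /u1 mulrN cosN. Qed.

Let u2N xi : (fun x : R => u2 xi (- x)) = u2 (- xi).
Proof.
apply/funext => x; rewrite /u2 !(mulrN, mulNr) !indicE.
suff -> : (- x \in (`[-1, 1]%classic : set R)) = (x \in (`[-1, 1]%classic : set R)) by [].
by rewrite !mem_setE !in_itv/= lerN2 lerNl andbC.
Qed.

(** The truncated part is linear in xi, so comparison with xi = 1 eliminates its transform. The
    bracket is the imaginary part of the kernel at i xi, and the multiple of xi becomes
    [SL_drift]. *)
Let laplace_u2 xi t : 0 < t -> laplace (u2 xi) t =
  xi * laplace (u2 1) t - (xi / (t ^+ 2 + xi ^+ 2) - xi / (1 + t ^+ 2)).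
Proof.
move=> t0; pose v (x : R) := x * \1_(`[-1, 1]%classic : set R) x.
have mv : measurable_fun setT v by apply: measurable_funM => //; exact: measurable_indic.
have v1 x : `|v x| <= 1.
  rewrite /v indicE; have [/set_mem|] := boolP (x \in _); last by rewrite mulr0 normr0.
  by rewrite /= in_itv/= mulr1 ler_norml.
have E a : laplace (u2 a) t = a * laplace v t - a / (t ^+ 2 + a ^+ 2).
  have -> : u2 a = (fun x => a * v x - sin (a * x)).
    by apply/funext => x; rewrite /u2 /v mulrA.
  rewrite (@laplaceB _ _ _ _ (1 + `|a|))//.
  - by rewrite (@laplaceZ _ _ _ 1)// laplace_sin.
  - exact: measurable_funM.
  - exact: measurable_sin_mul.
  - by move=> x; rewrite normrM; have := v1 x; have := normr_ge0 a; have := normr_ge0 (v x); nra.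
  - by move=> x; apply: le_trans (norm_sin_le1 _) _; rewrite lerDl.
by rewrite (E xi) (E 1) expr1n (addrC 1); ring.
Qed.

(** The weight is the Laplace transform of [u1 1], so this is the integrability part of
    [SL_integral]. *)
Lemma SL_weight_integrable :
  Gm.-integrable (above mup) (EFin \o @stieltjes_weight R) /\
  Gp.-integrable (above (- mum)) (EFin \o @stieltjes_weight R).
Proof.
have [_ im ip _] := SLu1 1; rewrite u1N in im.
have E t : 0 < t -> laplace (u1 1) t = stieltjes_weight t.
  move=> t0; rewrite /u1 laplace_1Bcos// /stieltjes_weight expr1n.
  have q : 1 + t ^+ 2 != 0 by rewrite gt_eqF// ltr_pwDl ?sqr_ge0.
  have tn : t != 0 by rewrite gt_eqF.
  by rewrite (addrC _ 1); field; rewrite q tn.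
have mA (a : R) := @measurable_above R a.
by split; [apply: eq_integrable im|apply: eq_integrable ip] => //;
  move=> t /set_mem[t0 _] /=; rewrite E.
Qed.

Let kernel_imag t xi : stieltjes_kernel t (xi *i) =
  (t / (t ^+ 2 + xi ^+ 2) - t^-1) +i* (xi / (t ^+ 2 + xi ^+ 2) - xi / (1 + t ^+ 2)).
Proof.
rewrite /stieltjes_kernel [LHS]complex_eta !ReD !ImD /=; congr (_ +i* _).
- by rewrite !subr0 sub0r sqrrN mul0r mulr0 !subr0.
- by rewrite !subr0 sub0r sqrrN mul0r mulNr opprK add0r.
Qed.

(* Change of drift from the truncation [\1_`[-1, 1]] to the compensator [z / (1 + t^2)]. *)
Definition SL_drift : R := \int[Gm]_(t in above mup) laplace (u2 1) t
  - \int[Gp]_(t in above (- mum)) laplace (u2 1) t.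

(* [- psi (- i z)] *)
Definition SL_cumulant (sigma2 b : R) (z : R[i]) : R[i] :=
  (sigma2 / 2)%:C * z ^+ 2 + (b + SL_drift)%:C * z +
  stieltjes Gp (- mum) z + stieltjes Gm mup (- z).

Let stieltjes_imag (G : {measure set R -> \bar R}) (a xi : R) : xi != 0 ->
  G.-integrable (above a) (EFin \o @stieltjes_weight R) ->
  G.-integrable (above a) (EFin \o laplace (u1 xi)) ->
  G.-integrable (above a) (EFin \o laplace (u2 xi)) ->
  G.-integrable (above a) (EFin \o laplace (u2 1)) ->
  stieltjes G a (xi *i) = (- \int[G]_(t in above a) laplace (u1 xi) t) +i*
    (xi * \int[G]_(t in above a) laplace (u2 1) t -
     \int[G]_(t in above a) laplace (u2 xi) t).
Proof.
move=> xi0 iw i1 i2 i21; have mA := @measurable_above R a.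
rewrite /stieltjes /cint; congr (_ +i* _).
- rewrite -mulN1r -(RintegralZl _ mA i1).
  apply: eq_Rintegral => t /set_mem[t0 _].
  by rewrite kernel_imag /= /u1 laplace_1Bcos// mulN1r opprB.
- have i3 : G.-integrable (above a) (EFin \o (fun t => xi * laplace (u2 1) t)).
    by have := integrableZl mA xi i21; apply: eq_integrable => // t _; rewrite /= EFinM.
  rewrite -(RintegralZl _ mA i21) -(RintegralB mA i3 i2).
  apply: eq_Rintegral => t /set_mem[t0 _].
  by rewrite kernel_imag /= (laplace_u2 xi)//; ring.
Qed.

Lemma levy_khintchine_cumulant (sigma2 b xi : R) : xi != 0 ->
  levy_khintchine sigma2 b F xi = - SL_cumulant sigma2 b (xi *i).
Proof.
move=> xi0; have [im ip] := SL_weight_integrable.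
have [_ i1m i1p E1] := SLu1 xi; rewrite u1N in E1 i1m.
have [_ i2m i2p E2] := SLu2 xi; rewrite u2N in E2 i2m.
have [_ _ j2p _] := SLu2 1.
(* The [Gm] part of the formula concerns the reflected function, so [u2 1] under [Gm] is reached
   from [u2 (-1)]. *)
have [_ j2m _ _] := SLu2 (-1); rewrite u2N opprK in j2m.
have u1E : u1 (- xi) = u1 xi by apply/funext => x; rewrite /u1 mulNr cosN.
have Sp := stieltjes_imag xi0 ip i1p i2p j2p.
have Sm : stieltjes Gm mup ((- xi) *i) = (- \int[Gm]_(t in above mup) laplace (u1 xi) t) +i*
    (- xi * \int[Gm]_(t in above mup) laplace (u2 1) t -
     \int[Gm]_(t in above mup) laplace (u2 (- xi)) t).
  have := @stieltjes_imag Gm mup (- xi); rewrite u1E; apply => //.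
  by rewrite oppr_eq0.
rewrite /SL_cumulant (_ : - (xi *i) = (- xi) *i); last by rewrite -[LHS]/(- 0 +i* - xi) oppr0.
rewrite Sp Sm /levy_khintchine [LHS]complex_eta [RHS]complex_eta.
have E1' : \int[F]_x complex.Re (1 - cexp ((xi * x) *i)
    + (xi * x * \1_(`[-1, 1]%classic : set R) x) *i) = \int[F]_x u1 xi x.
  by apply: eq_Rintegral => x _; rewrite /u1 /= expR0 mul1r mul0r subr0 addr0.
have E2' : \int[F]_x complex.Im (1 - cexp ((xi * x) *i)
    + (xi * x * \1_(`[-1, 1]%classic : set R) x) *i) = \int[F]_x u2 xi x.
  apply: eq_Rintegral => x _; rewrite /u2 /= expR0 mul1r mul0r addr0 sub0r.
  by rewrite addrC.
rewrite /cintegral E1' E2' E1 E2 /SL_drift.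
move: (\int[Gm]_(t in _) laplace (u1 xi) t) (\int[Gp]_(t in _) laplace (u1 xi) t).
move: (\int[Gm]_(t in _) laplace (u2 1) t) (\int[Gp]_(t in _) laplace (u2 1) t).
move: (\int[Gm]_(t in _) laplace (u2 (- xi)) t) (\int[Gp]_(t in _) laplace (u2 xi) t).
by move=> i1 i2 i3 i4 i5 i6; congr (_ +i* _) => /=; ring.
Qed.

End levy_khintchine.

(** * Functions with nonincreasing ratio *)

Section nonincreasing_ratio.
Variables (R : realType) (g : R -> R) (a q : R).
Hypotheses (a0 : a < 0) (q0 : 0 < q).
Hypothesis gc : forall x, a < x < 0 -> {for x, continuous g}.
Hypothesis gratio : forall x y, a < x -> x <= y -> y < 0 -> g y / y <= g x / x.

(** At a solution the ratio g x / x equals - q / x, which is strictly increasing on (a, 0) while the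
    ratio is nonincreasing. *)
Lemma nonincreasing_ratio_inj x y : a < x < 0 -> a < y < 0 ->
  g x = - q -> g y = - q -> x = y.
Proof.
have H u v : a < u < 0 -> a < v < 0 -> g u = - q -> g v = - q -> u < v -> False.
  move=> /andP[au u0] /andP[av v0] gu gv uv.
  have := gratio au (ltW uv) v0; rewrite gu gv.
  rewrite !mulNr lerN2 ler_pM2l// => uv'.
  have : u^-1 > v^-1 by rewrite ltf_nV2 ?negrE.
  by rewrite ltNge uv'.
move=> ax ay gx gy; apply/eqP; rewrite eq_le !leNgt; apply/andP; split; apply/negP => xy.
- exact: H ay ax gy gx xy.
- exact: H ax ay gx gy xy.
Qed.

(** Monotonicity is known for the ratio, not for g: the ratio has a limit in the extended reals,
    possibly +oo, and g is the ratio times x. *)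
Lemma nonincreasing_ratio_cvg : cvg ((g x)%:E @[x --> a^'+]).
Proof.
pose h x := (g x / x)%:E.
have hc : h x @[x --> a^'+] --> ereal_sup (h @` `]a, 0[).
  apply: (@nonincreasing_at_right_cvge _ _ _ (BLeft 0)); first by rewrite bnd_simp.
  move=> x y; rewrite !in_itv/= => /andP[ax _] /andP[_ y0] xy.
  by rewrite lee_fin; exact: gratio.
have xc : x%:E @[x --> a^'+] --> a%:E.
  by apply: cvg_EFin; [exact: nearW|exact: cvg_at_right_filter].
move: hc; set H := ereal_sup _ => hc.
(* As a < 0, the product of limits is never 0 times infinity. *)
have aH : (a%:E *? H)%E.
  have [Hf|Hf] := boolP (H \is a fin_num); first exact: mule_def_fin.
  by apply: mule_def_neq0_infty => //; rewrite eqe lt_eqF.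
apply/cvg_ex; exists (a%:E * H)%E; apply: cvg_trans (cvgeM aH xc hc).
apply: near_eq_cvg.
near=> x; rewrite /h -EFinM; congr EFin.
have x0 : x < 0 by near: x; exact: nbhs_right_lt.
by rewrite mulrC divfK// lt_eqF.
Unshelve. all: by end_near. Qed.

Lemma nonincreasing_ratio_solvable :
  (exists2 x, a < x < 0 & g x = - q) <->
  (lim ((g x)%:E @[x --> a^'+]) + q%:E < 0)%E.
Proof.
have cv := nonincreasing_ratio_cvg; split.
(* A limit inherits only weak inequalities. For y < x1 one has g y <= - q y / x <= - q x1 / x, and
   x1 / x > 1 keeps the bound strictly below - q. *)
- move=> [x /andP[ax x0] gx]; pose x1 := (a + x) / 2.
  have [ax1 x1x] : a < x1 /\ x1 < x by rewrite /x1; split; lra.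
  have : (lim ((g x)%:E @[x --> a^'+]) <= (- q * (x1 / x))%:E)%E.
    apply: lime_le => //; near=> y; rewrite lee_fin.
    have ay : a < y by near: y; exact: nbhs_right_gt.
    have yx1 : y < x1 by near: y; exact: nbhs_right_lt.
    have y0 : y < 0 by lra.
    have := gratio ay (ltW (lt_trans yx1 x1x)) x0.
    rewrite ler_ndivlMr// gx => /le_trans; apply.
    rewrite (_ : - q / x * y = - q * (y / x)); last by ring.
    by rewrite ler_nM2l ?oppr_lt0// ler_nM2r ?invr_lt0// ltW.
  move=> /(leeD2r q%:E)/le_lt_trans; apply.
  rewrite -EFinD lte_fin -{2}(mulr1 q) mulNr addrC -mulrBr pmulr_rlt0// subr_lt0.
  by rewrite ltr_ndivlMr// mul1r.
- move=> Lq; have [x /andP[ax x0] gx] : exists2 x, a < x < 0 & g x < - q.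
    apply: contrapT => nex; move: Lq; apply/negP; rewrite -leNgt.
    have : ((- q)%:E <= lim ((g x)%:E @[x --> a^'+]))%E.
      apply: lime_ge => //; near=> y; rewrite lee_fin leNgt; apply/negP => gy.
      apply: nex; exists y => //; apply/andP; split.
      - by near: y; exact: nbhs_right_gt.
      - by near: y; exact: nbhs_right_lt.
    by move=> /(leeD2r q%:E); rewrite -EFinD addNr.
  (* Chosen so that the ratio inequality reads g y >= (g x / x) y = - q / 2 > - q. This replaces
     continuity at 0 and gives the second endpoint for the intermediate value theorem. *)
  have qpos := q0; pose y := x * (q / (2 * - g x)).
  have gx0 : 0 < - g x by rewrite oppr_gt0 (lt_trans gx)// oppr_lt0.
  have r0 : 0 < q / (2 * - g x) by rewrite divr_gt0 ?mulr_gt0.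
  have r1 : q / (2 * - g x) < 1 by rewrite ltr_pdivrMr ?mulr_gt0// mul1r; lra.
  have xy : x < y by rewrite /y ltr_nMr.
  have y0 : y < 0 by rewrite /y nmulr_rlt0.
  have gy : - q < g y.
    have := gratio ax (ltW xy) y0; rewrite ler_ndivrMr//.
    have -> : g x / x * y = - (q / 2).
      by rewrite /y; field; rewrite !lt_eqF//; lra.
    by lra.
  have [|||c] := @IVT R g x y (- q).
  + exact: ltW.
  + apply: continuous_in_subspaceT => c /set_mem; rewrite /= in_itv/= => /andP[xc cy].
    by apply: gc; rewrite (lt_le_trans ax xc) (le_lt_trans cy y0).
  + by rewrite ge_min le_max (ltW gx) (ltW gy) orbT.
  rewrite in_itv/= => /andP[xc cy] gcq; exists c => //.
  by rewrite (lt_le_trans ax xc) (le_lt_trans cy y0).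
Unshelve. all: by end_near. Qed.

End nonincreasing_ratio.

(** The moduli at t = 1 give equal real parts. If the imaginary parts differed, t = pi / |b - e|
    would make the phases differ by pi, although their cosines and sines agree. *)
Lemma cexp_ray_inj (R : realType) (u v : R[i]) :
  (forall t : R, 0 <= t -> cexp (- t%:C * u) = cexp (- t%:C * v)) -> u = v.
Proof.
case: u v => [a b] [c e] H.
have H' (t : R) : 0 <= t ->
    expR (- (t * a)) * cos (t * b) = expR (- (t * c)) * cos (t * e) /\
    expR (- (t * a)) * sin (t * b) = expR (- (t * c)) * sin (t * e).
  move=> t0; have := H t t0; rewrite /cexp /=.
  rewrite !oppr0 !mul0r subr0 !addr0 subr0 !mulNr !cosN !sinN.
  move=> [+ +]; rewrite !mul0r !subr0 !addr0 !mulrN => -> /oppr_inj.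
  by [].
have ac : a = c.
  have [H1 H2] := H' 1 ler01; rewrite !mul1r in H1 H2.
  have : expR (- a) ^+ 2 = expR (- c) ^+ 2.
    rewrite -[LHS]mulr1 -(cos2Dsin2 b) -[RHS]mulr1 -(cos2Dsin2 e).
    by rewrite !mulrDr -!exprMn H1 H2.
  move/eqP; rewrite eqrXn2 ?expR_ge0// => /eqP /expR_inj /oppr_inj//.
rewrite {}ac in H H' *; congr (_ +i* _).
apply/eqP; rewrite -subr_eq0; apply/negPn/negP => be.
pose t := pi / `|b - e|.
have t0 : 0 <= t by rewrite divr_ge0// pi_ge0.
have [H1 H2] := H' t t0.
have E0 : expR (- (t * c)) != 0 by rewrite gt_eqF// expR_gt0.
move/(mulfI E0) in H1; move/(mulfI E0) in H2.
have : cos (t * b - t * e) = 1 by rewrite cosB H1 H2 -!expr2 cos2Dsin2.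
have -> : cos (t * b - t * e) = cos (pi : R).
  rewrite -mulrBr /t; have [p|n] := leP 0 (b - e).
    by rewrite ger0_norm// divfK.
  by rewrite ltr0_norm// invrN mulrN mulNr divfK// cosN.
by rewrite cospi => /eqP; rewrite eq_sym -subr_eq0 opprK (pnatr_eq0 _ 2).
Qed.

(** * Closure properties of local power series *)

Section power_series_more.
Variable R : realType.
Implicit Types (f g : R[i] -> R[i]) (z : R[i]).

Lemma has_power_series_quadratic (a b : R[i]) z :
  has_power_series (fun w => a * w ^+ 2 + b * w) z.
Proof.
pose c k := match k with 0%N => a * z ^+ 2 + b * z | 1%N => 2 * a * z + b | 2%N => a | _ => 0 end.
apply: (@power_series_of_ge2 _ _ _ c 1 (normc a)) => // h h1 [|[|[|n]]]// _.
  rewrite !big_nat_recr//= big_nil divr1.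
  rewrite (_ : _ - _ = a * h ^+ 2); first by rewrite normcM normcX.
  by rewrite /c; ring.
rewrite [X in normc X](_ : _ = 0);
  first by rewrite normc0 mulr_ge0 ?normc_ge0 ?exprn_ge0 ?divr_ge0 ?normc_ge0.
rewrite (@big_cat_nat _ _ _ 3)//= [X in _ - (_ + X)]big_nat_cond.
rewrite [X in _ - (_ + X)]big1.
  by rewrite !big_nat_recr//= big_nil /c; ring.
by move=> [|[|[|k]]]//= _; rewrite mul0r.
Qed.

Lemma has_power_seriesD f g z : has_power_series f z -> has_power_series g z ->
  has_power_series (fun w => f w + g w) z.
Proof.
move=> pf pg.
have := has_power_seriesB pf (has_power_seriesB (has_power_series_quadratic 0 0 z) pg).
by congr has_power_series; apply/funext => w; ring.
Qed.

Lemma has_power_series_rotation f (u : R[i]) z : normc u = 1 ->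
  has_power_series f (u * z) -> has_power_series (fun w => f (u * w)) z.
Proof.
move=> u1 [c [r [B [r0 H]]]]; exists (fun k => c k * u ^+ k), r, B; split => // h hr n.
have uh : normc (u * h) = normc h by rewrite normcM u1 mul1r.
have := H (u * h); rewrite uh => /(_ hr n).
rewrite mulrDr; congr (normc (_ - _) <= _).
by apply: eq_bigr => k _; rewrite exprMn mulrA.
Qed.

Lemma has_power_series_opp f z :
  has_power_series f (- z) -> has_power_series (fun w => f (- w)) z.
Proof.
move=> pf; have -> : (fun w => f (- w)) = (fun w => f (-1 * w)).
  by apply/funext => w; rewrite mulN1r.
apply: has_power_series_rotation; last by rewrite mulN1r.
by rewrite normcN normc1.
Qed.

Lemma analytic_has_power_series (D : set R[i]) f z : analytic_on D f -> D z ->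
  has_power_series f z.
Proof.
move=> anf /anf [c [r [r0 H]]].
apply: (@power_series_of_limit _ _ _ c r r0) => h hr e e0.
have hr' : `|z + h - z| < r%:C by rewrite addrAC subrr add0r normr_normc ltcR.
have := H _ hr'; rewrite addrAC subrr add0r => /cvgrPdist_le/(_ e%:C).
rewrite ltcR => /(_ e0)[N _ HN]; exists N => n Nn.
by have := HN n Nn; rewrite normr_normc lecR.
Qed.

End power_series_more.

(** * The cumulant off the cuts *)

Section SL_cumulant_theory.
Variables (R : realType) (mum mup : R) (F Gm Gp : {measure set R -> \bar R}).
Hypotheses (SLM_Gm : SLM mup Gm) (SLM_Gp : SLM (- mum) Gp).
Hypothesis FE : forall A : set R, measurable A ->
  F A = (\int[lebesgue_measure]_(x in A) SL_density Gm Gp x)%E.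
Hypothesis levyF : is_levy_measure F.
Variables (sigma2 b : R).
Hypothesis sigma2_ge0 : 0 <= sigma2.
Local Notation kappa := (SL_cumulant mum mup Gm Gp sigma2 b).

Let iW := SL_weight_integrable SLM_Gm SLM_Gp FE levyF.
Let im : Gm.-integrable (above mup) (EFin \o @stieltjes_weight R).
Proof. exact: iW.1. Qed.
Let ip : Gp.-integrable (above (- mum)) (EFin \o @stieltjes_weight R).
Proof. exact: iW.2. Qed.

(** The set [SL_domain mum mup] seen in the variable z = i xi. *)
Definition cumulant_domain (z : R[i]) : Prop :=
  complex.Im z <> 0 \/ - mup < complex.Re z < - mum.

Let off_cut_p z : cumulant_domain z -> off_cut (- mum) z.
Proof. by move=> [z0|/andP[_ z1]]; [left|right]. Qed.

Let off_cut_m z : cumulant_domain z -> off_cut mup (- z).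
Proof.
case: z => x y [/= y0|/= /andP[z1 _]]; [left => /= /eqP|right => /=].
  by rewrite oppr_eq0 => /eqP.
by rewrite ltrNl.
Qed.

Lemma cumulant_power_series z : cumulant_domain z -> has_power_series kappa z.
Proof.
move=> Dz; apply: has_power_seriesD; first apply: has_power_seriesD.
- exact: has_power_series_quadratic.
- exact: stieltjes_power_series (off_cut_p Dz).
- exact: has_power_series_opp (stieltjes_power_series im (off_cut_m Dz)).
Qed.

(* Multiplying by the conjugate of [z] turns the half-plane property of
   [kappa z / z] into a sign of [Im (kappa z * z^* )]. *)
Lemma cumulant_neq (q : R) z : 0 < q -> complex.Im z <> 0 -> kappa z <> q%:C.
Proof.
move=> q0 z0 kq.
have Hp := stieltjes_Im_conj ip z0.
have Nz0 : complex.Im (- z) <> 0.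
  by case: (z) z0 => x y /= y0 /eqP; rewrite oppr_eq0 => /eqP.
have Hm := stieltjes_Im_conj im Nz0.
have : complex.Im z * complex.Im (kappa z * z^*) = complex.Im z * complex.Im (q%:C * z^*).
  by rewrite kq.
rewrite /SL_cumulant !mulrDl !ImD.
move: Hp Hm; rewrite rmorphN mulrN.
move: (stieltjes Gp (- mum) z * z^*) (stieltjes Gm mup (- z) * z^*) => A B.
case: z A B z0 {Nz0 kq} => x y [A1 A2] [B1 B2] /= y0 Hp Hm.
have y2 : 0 < y ^+ 2 by rewrite lt0r sqr_ge0 sqrf_eq0 andbT; apply/eqP.
have s2 : 0 <= sigma2 / 2 * (x ^+ 2 + y ^+ 2) * y ^+ 2.
  by rewrite mulr_ge0 ?(ltW y2)// mulr_ge0 ?addr_ge0 ?sqr_ge0// divr_ge0.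
have qy : 0 < q * y ^+ 2 by rewrite mulr_gt0.
move=> E.
(* The drift term times the conjugate of z is real and drops out; what remains equates a
   non-negative sum with a negative number. *)
have : sigma2 / 2 * (x ^+ 2 + y ^+ 2) * y ^+ 2 + y * A2 + y * B2 = - (q * y ^+ 2).
  apply: etrans (etrans E _); ring.
by move: Hm; rewrite mulrNN; lra.
Qed.

Lemma cumulant_real (x : R) : - mup < x < - mum -> complex.Im (kappa x%:C) = 0.
Proof.
move=> /andP[x1 x2]; rewrite /SL_cumulant -rmorphXn -!rmorphM -rmorphN !ImD.
by rewrite !stieltjes_real ?addr0//; lra.
Qed.

(** For the [Gm] term the sign changes twice: its ratio at - u is nonincreasing in u, and dividing
    by u instead of - u reverses this. *)
Lemma cumulant_ratio (x y : R) : x != 0 -> y != 0 ->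
  - mup < x -> x <= y -> y < - mum ->
  complex.Re (kappa x%:C) / x <= complex.Re (kappa y%:C) / y.
Proof.
move=> x0 y0 mx xy ym.
have Hp := stieltjes_div_nondecreasing ip x0 y0 xy ym.
have Nx0 : - x != 0 by rewrite oppr_eq0.
have Ny0 : - y != 0 by rewrite oppr_eq0.
have Hm : complex.Re (stieltjes Gm mup (- y)%:C) / - y <=
    complex.Re (stieltjes Gm mup (- x)%:C) / - x.
  by apply: (stieltjes_div_nondecreasing im) => //; lra.
have E u : u != 0 -> complex.Re (kappa u%:C) / u =
    sigma2 / 2 * u + (b + SL_drift mum mup Gm Gp) +
    complex.Re (stieltjes Gp (- mum) u%:C) / u
    - complex.Re (stieltjes Gm mup (- u)%:C) / - u.
  move=> u0; rewrite /SL_cumulant -rmorphXn -!rmorphM -rmorphN !ReD.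
  have ReC (v : R) : complex.Re v%:C = v by [].
  by rewrite !ReC; field.
rewrite !E//.
have : sigma2 / 2 * x <= sigma2 / 2 * y by rewrite ler_wpM2l// divr_ge0.
by lra.
Qed.

End SL_cumulant_theory.

(** * Continuation to the whole domain and the zeros of q + psi *)

Theorem theorem4p2 (d : measure_display) (T : measurableType d) (R : realType)
    (P : probability T R) (X : R -> {RV P >-> R}) (mum mup : R)
    (psi : R[i] -> R[i])
    (mum_le0 : mum <= 0) (mup_ge0 : 0 <= mup)
    (SL_X : is_SL_process X mum mup)
    (psi_X : continued_characteristic_exponent X mum mup psi) :
  (forall q : R, 0 < q ->
     solutions psi q [set xi | complex.Re xi <> 0] = set0) /\
  (mum < mup -> forall q : R, 0 < q ->
     [/\ (solutions psi q (imaginary_interval mum 0) = set0 \/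
          exists xi, solutions psi q (imaginary_interval mum 0) = [set xi]),
         (solutions psi q (imaginary_interval 0 mup) = set0 \/
          exists xi, solutions psi q (imaginary_interval 0 mup) = [set xi]),
         (solutions psi q (imaginary_interval mum 0) !=set0 <->
          mum < 0 /\ (psi_lower psi mum + q%:E < 0)%E) &
         (solutions psi q (imaginary_interval 0 mup) !=set0 <->
          0 < mup /\ (psi_upper psi mup + q%:E < 0)%E)]).
Proof.
case: SL_X => _ [sigma2 [b [F [Gm [Gp [[sigma2_ge0 levyF lkX] SLM_Gm SLM_Gp FE]]]]]].
case: psi_X => charX psi_an.
pose kappa := SL_cumulant mum mup Gm Gp sigma2 b.
have psi_real (x : R) : psi x%:C = levy_khintchine sigma2 b F x.
  by apply: cexp_ray_inj => t t0; rewrite -charX// lkX.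
have psi_imag (x : R) : x != 0 -> psi x%:C = - kappa (x *i).
  by move=> x0; rewrite psi_real (levy_khintchine_cumulant SLM_Gm SLM_Gp FE).
(* Multiplication by - i leads from the variable z of kappa back to xi. *)
pose J : R[i] := (-1) *i.
have J1 : normc J = 1 by rewrite normc_imag normrN normr1.
have J_iE (x y : R) : J * (x +i* y) = y +i* (- x).
  by apply/eqP; rewrite eq_complex /= !mul0r !mulN1r sub0r opprK add0r !eqxx.
pose phi z := psi (J * z) + kappa z.
have Ddom z : cumulant_domain mum mup z -> SL_domain mum mup (J * z).
  case: z => x y Dz; rewrite J_iE => -[y' [|] /=]; rewrite in_itv/= ?andbT => Hy' [y0 y'x];
    case: Dz => /= [|/andP[x1 x2]]; try by rewrite -y0.
  - by move: Hy'; rewrite y'x; lra.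
  - by move: Hy'; rewrite y'x; lra.
have phi_ps z : cumulant_domain mum mup z -> has_power_series phi z.
  move=> Dz; apply: has_power_seriesD.
    apply: has_power_series_rotation => //.
    exact: analytic_has_power_series psi_an (Ddom z Dz).
  exact: (cumulant_power_series SLM_Gm SLM_Gp FE levyF sigma2 b Dz).
have phi_imag (x : R) : x != 0 -> phi (x *i) = 0.
  by move=> x0; rewrite /phi J_iE oppr0 psi_imag// addNr.
have phi0 z : cumulant_domain mum mup z -> phi z = 0.
  (* The segment from i or - i to a point of the same closed half-plane meets the real axis at most
     in its endpoint z', hence stays in the domain even if the cuts meet at 0. *)
  have base (e : R) z' : e = 1 \/ e = -1 -> 0 <= e * complex.Im z' ->
      cumulant_domain mum mup z' -> phi z' = 0.
    move=> e1 ez' Dz'.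
    have e2 : e * e = 1 by case: e1 => ->; rewrite ?mulr1// mulrNN mulr1.
    have en0 : e != 0 by case: e1 => ->; rewrite ?oppr_eq0 oner_eq0.
    apply: (@identity_on_segment _ phi (e *i)).
    - move=> s /andP[s0 s1]; have [->|sn1] := eqVneq s 1.
        by rewrite mul1r addrC subrK; exact: phi_ps.
      apply: phi_ps; left; case: z' ez' {Dz'} => x y /= ez'.
      rewrite !mul0r !addr0 => /(congr1 (fun u => e * u)).
      have s1' : s < 1 by rewrite lt_neqAle sn1.
      rewrite mulr0 mulrDr mulrCA mulrBr e2.
      have : 0 <= s * (e * y) by rewrite mulr_ge0.
      by lra.
    (* Zeros of [phi] accumulate at the base point along the imaginary axis; moving away from the
       origin avoids the excluded point 0. *)
    - move=> r r0; exists ((e * (r / 2)) *i); split.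
      + rewrite eq_complex /= eqxx /= mulf_neq0//.
        by rewrite gt_eqF// divr_gt0.
      + rewrite normc_imag normrM (_ : `|e| = 1) ?mul1r; last by case: e1 => ->; rewrite ?normrN normr1.
        by rewrite gtr0_norm; lra.
      + rewrite (_ : _ + _ = (e + e * (r / 2)) *i); last by simpc.
        apply: phi_imag; rewrite -{1}(mulr1 e) -mulrDr mulf_neq0//.
        by rewrite gt_eqF//; lra.
  move=> Dz; have [z0|z0] := leP 0 (complex.Im z).
    by apply: (base 1) => //; [left|rewrite mul1r].
  by apply: (base (-1)) => //; [right|rewrite mulN1r oppr_ge0 ltW].
have psiE z : cumulant_domain mum mup z -> psi (J * z) = - kappa z.
  by move=> /phi0 /eqP; rewrite addr_eq0 => /eqP.
split.
  move=> q q0; rewrite -subset0 => -[x y] [/= x0 E].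
  (* The real part of xi is the imaginary part of z, so the claim is [cumulant_neq]. *)
  have E1 : J * ((- y) +i* x) = x +i* y by rewrite J_iE opprK.
  have D1 : cumulant_domain mum mup ((- y) +i* x) by left.
  apply: (cumulant_neq SLM_Gm SLM_Gp FE levyF sigma2_ge0 q0 (z := (- y) +i* x) (b := b)) => //.
  by apply/esym/eqP; rewrite -subr_eq0 -(psiE _ D1) E1 E.
move=> mm q q0.
pose g (y : R) := complex.Re (psi (y *i)).
have Dy (y : R) : mum < y < mup -> cumulant_domain mum mup (- y)%:C.
  by move=> /andP[y1 y2]; right => /=; lra.
have psi_y (y : R) : mum < y < mup -> psi (y *i) = - kappa (- y)%:C.
  by move=> /Dy/psiE <-; rewrite J_iE opprK.
have psi_g (y : R) : mum < y < mup -> psi (y *i) = (g y)%:C.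
  move=> ym; rewrite [LHS]complex_eta -/(g y); congr (_ +i* _).
  rewrite psi_y//; apply/eqP; rewrite -[X in X == _]/(complex.Im (- _)).
  have Nym : - mup < - y < - mum by case/andP: ym => *; lra.
  have := cumulant_real Gm Gp sigma2 b Nym.
  by rewrite -/kappa; case: (kappa _) => u v /= ->; rewrite oppr0.
have g_cont (y : R) : mum < y < mup -> {for y, continuous g}.
  move=> ym.
  have : has_power_series psi (y *i).
    have := Ddom _ (Dy y ym); rewrite J_iE opprK.
    exact: analytic_has_power_series.
  move=> /has_power_series_continuous pc.
  apply/cvgrPdist_le => e e0; have [r r0 Hr] := pc e e0.
  near=> x.
  have xr : normc ((x - y) *i) < r.
    by rewrite normc_imag distrC; near: x; exact: cvgr_dist_lt.
  have := Hr _ xr; rewrite (_ : y *i + _ = x *i); last by simpc; rewrite addrC subrK.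
  apply: le_trans; rewrite distrC; apply: le_trans (normc_ge_absRe _).
  by rewrite ReD /g; case: (psi (y *i)).
(* Since psi(iy) = - kappa(-y), the ratio g y / y is that of kappa at - y, and the reflection turns
   nondecreasing into nonincreasing. *)
have g_ratio (x y : R) : x != 0 -> y != 0 -> mum < x -> x <= y -> y < mup ->
    g y / y <= g x / x.
  move=> x0 y0 mx xy ym; have xm := le_lt_trans xy ym; have my := lt_le_trans mx xy.
  have gE u : mum < u < mup -> g u / u = complex.Re (kappa (- u)%:C) / - u.
    by move=> um; rewrite /g psi_y// invrN mulrN -mulNr; congr (_ / _).
  rewrite !gE ?mx ?my//.
  by apply: (cumulant_ratio SLM_Gm SLM_Gp FE levyF) => //; rewrite ?oppr_eq0//; lra.
have sol (lo hi : R) xi : mum <= lo -> hi <= mup ->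
    solutions psi q (imaginary_interval lo hi) xi <->
    exists y, [/\ lo < y < hi, xi = y *i & g y = - q].
  move=> mlo him; split.
  - move=> [[y /=]]; rewrite in_itv/= => /andP[y1 y2] <- E; exists y; split => //.
      by rewrite y1.
    move: E; rewrite psi_g; last by rewrite (le_lt_trans mlo y1) (lt_le_trans y2 him).
    by rewrite -rmorphD => -[/eqP]; rewrite addrC addr_eq0 => /eqP.
  - move=> [y [/andP[y1 y2] -> gy]]; split.
      by exists y => //=; rewrite in_itv/= y1.
    rewrite psi_g; last by rewrite (le_lt_trans mlo y1) (lt_le_trans y2 him).
    by rewrite gy -rmorphD subrr.
have uniq (lo hi : R) : mum <= lo -> hi <= mup ->
    (forall x y, lo < x < hi -> lo < y < hi -> g x = - q -> g y = - q -> x = y) ->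
    solutions psi q (imaginary_interval lo hi) = set0 \/
    exists xi, solutions psi q (imaginary_interval lo hi) = [set xi].
  move=> mlo him inj.
  have [[xi Hxi]|no] := pselect (solutions psi q (imaginary_interval lo hi) !=set0).
  - right; exists xi; apply/seteqP; split; last by move=> _ ->.
    move=> xi' /(sol _ _ _ mlo him) [y' [y'i -> gy']].
    by move: Hxi => /(sol _ _ _ mlo him) [y [yi -> gy]] /=; rewrite (inj y' y).
  - by left; rewrite -subset0 => xi Hxi; apply: no; exists xi.
have ne (lo hi : R) : mum <= lo -> hi <= mup ->
    solutions psi q (imaginary_interval lo hi) !=set0 <->
    exists2 y, lo < y < hi & g y = - q.
  move=> mlo him; split; first by move=> [xi /(sol _ _ _ mlo him)[y [yi _ gy]]]; exists y.
  by move=> [y yi gy]; exists (y *i); apply/(sol _ _ _ mlo him); exists y.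
have lower_c y : mum < y < 0 -> {for y, continuous g}.
  by move=> /andP[y1 y2]; apply: g_cont; rewrite y1 (lt_le_trans y2).
have lower_r x y : mum < x -> x <= y -> y < 0 -> g y / y <= g x / x.
  move=> mx xy y0; apply: g_ratio => //; last exact: lt_le_trans mup_ge0.
  - by rewrite lt_eqF// (le_lt_trans xy).
  - by rewrite lt_eqF.
(* Reflection moves (0, mup) to (- mup, 0). The ratio changes sign while the order is reversed, so
   it is again nonincreasing and the same lemmas serve the upper interval. *)
pose g' y := g (- y).
have upper_c y : - mup < y < 0 -> {for y, continuous g'}.
  move=> /andP[y1 y2]; apply: continuous_comp; first exact: opp_continuous.
  by apply: g_cont; apply/andP; split; lra.
have upper_r x y : - mup < x -> x <= y -> y < 0 -> g' y / y <= g' x / x.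
  move=> mx xy y0.
  have gN u : g' u / u = - (g (- u) / - u) by rewrite /g' invrN mulrN opprK.
  have x0 := le_lt_trans xy y0.
  by rewrite !gN lerN2; apply: g_ratio; rewrite ?oppr_eq0 ?lt_eqF//; lra.
have upper_sol : (exists2 y, 0 < y < mup & g y = - q) <->
    (exists2 y, - mup < y < 0 & g' y = - q).
  split=> -[y /andP[y1 y2] gy]; exists (- y); rewrite /g' ?opprK//;
    by apply/andP; split; lra.
have upper_lim : lim ((g' y)%:E @[y --> (- mup)^'+]) = psi_upper psi mup.
  rewrite /psi_upper at_rightN -fmap_comp.
  rewrite (_ : _ \o _ = (fun t : R => (complex.Re (psi (t *i)))%:E))//.
  by apply/funext => y; rewrite /= /g' opprK.
split.
- by apply: uniq => //; exact: (nonincreasing_ratio_inj q0 lower_r).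
- apply: uniq => //.
  move=> x y /andP[x1 x2] /andP[y1 y2] gx gy; apply: oppr_inj.
  apply: (nonincreasing_ratio_inj q0 upper_r); rewrite /g' ?opprK//;
    by apply/andP; split; lra.
- rewrite ne//; split.
    move=> Hy; have m0 : mum < 0 by case: Hy => y /andP[? ?] _; lra.
    by split => //; apply/(nonincreasing_ratio_solvable m0 q0 lower_c lower_r).
  by move=> [m0 H]; apply/(nonincreasing_ratio_solvable m0 q0 lower_c lower_r).
- rewrite ne// upper_sol -upper_lim; split.
    move=> Hy; have m0 : 0 < mup by case: Hy => y /andP[? ?] _; lra.
    have Nm0 : - mup < 0 by lra.
    by split => //; apply/(nonincreasing_ratio_solvable Nm0 q0 upper_c upper_r).
  move=> [m0 H]; have Nm0 : - mup < 0 by lra.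
  by apply/(nonincreasing_ratio_solvable Nm0 q0 upper_c upper_r).
Unshelve. all: by end_near. Qed.
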